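(* Let $\Omega\subset\mathbb{R}^d$ be a non-empty, bounded, open set and let $\Phi\colon\mathbb{R}^N_+\to[0,\infty)$ satisfy (Φ.1), (Φ.2) and (Φ.3). Then there exists a $\Phi$-Cheeger $N$-cluster of $\Omega$, i.e. an $N$-cluster attaining $H^{\Phi,N}(\Omega)$. Consequently (combined with the equality $\mathscr{L}^{\Phi,N}_{1,1}(\Omega)=H^{\Phi,N}(\Omega)$) there also exists a $(1,\Phi)$-eigen-$N$-cluster of $\Omega$.
   Context: All sets are Lebesgue measurable; $|E|$ is Lebesgue measure and $P(E)$ the distributional perimeter; inclusions/disjointness are up to null sets. For $F\subset\mathbb{R}^d$, $h(F)=\inf\{P(E)/|E| : E\subset F,\ |E|>0\}$. An $N$-set of $F$ is an $N$-tuple $\mathcal E=(\mathcal E_1,\dots,\mathcal E_N)$ with $\mathcal E_i\subset F$, $|\mathcal E_i|>0$, $|\mathcal E_i\cap\mathcal E_j|=0$ for $i\ne j$; an $N$-cluster if moreover $P(\mathcal E_i)<\infty$. $\mathbb{R}^N_+=\{v\in\mathbb{R}^N:v_i\ge0\}$ with componentwise order. (Φ.1): $\Phi$ lower semicontinuous. (Φ.2): there is $\delta>0$ with $\Phi(v)\ge\delta\sum_i v_i$ for all $v$. (Φ.3): $v\le w\Rightarrow\Phi(v)\le\Phi(w)$. $H^{\Phi,N}(F)=\inf\{\Phi(P(\mathcal E_1)/|\mathcal E_1|,\dots,P(\mathcal E_N)/|\mathcal E_N|) : \mathcal E \text{ an } N\text{-cluster of } F\}$, minimizers: $\Phi$-Cheeger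 $N$-clusters. $\mathscr{L}^{\Phi,N}_{1,1}(F)=\inf\{\Phi(h(\mathcal E_1),\dots,h(\mathcal E_N)) : \mathcal E \text{ an } N\text{-set of } F\}$; a minimizer that is an $N$-cluster is a $(1,\Phi)$-eigen-$N$-cluster. *)

(* Defs.v *)
From HB Require Import structures.
From mathcomp Require Import all_boot all_order all_algebra.
From mathcomp Require Import all_classical all_reals all_analysis.
Set Implicit Arguments. Unset Strict Implicit. Unset Printing Implicit Defensive.
Import Order.TTheory GRing.Theory Num.Theory.
Import numFieldNormedType.Exports.
Local Open Scope classical_set_scope.
Local Open Scope ring_scope.

Section Defs.
Variables (R : realType) (d : nat).
Notation V := 'rV[R]_d.

Definition box (a b : V) : set V := [set x | forall i, a 0 i <= x 0 i <= b 0 i].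
Definition boxvol (a b : V) : R := \prod_(i < d) Num.max 0 (b 0 i - a 0 i).

(** Lebesgue (outer) measure on R^d: infimum of total volumes of countable
    covers by boxes.  On Lebesgue measurable sets this is Lebesgue measure. *)
Definition leb (E : set V) : \bar R :=
  ereal_inf [set s | exists a b : nat -> V,
     E `<=` \bigcup_k box (a k) (b k) /\
     s = (\sum_(0 <= k <oo) (boxvol (a k) (b k))%:E)%E].

Definition lmeas (E : set V) : Prop := leb.-caratheodory E.

Definition null (E : set V) : Prop := leb E = 0%E.

(** Lebesgue integral over E of a real function g (layer-cake formula). *)
Definition integ (E : set V) (g : V -> R) : \bar R :=
  (\int[@lebesgue_measure R]_(t in `[0%R, +oo[%classic)
       leb (E `&` [set x | (t < g x)%R])
   - \int[@lebesgue_measure R]_(t in `[0%R, +oo[%classic)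
       leb (E `&` [set x | (g x < - t)%R]))%E.

Definition unitv (j : 'I_d) : V := delta_mx 0 j.
Definition compo (phi : V -> V) (i : 'I_d) : V -> R := fun x => phi x 0 i.

Definition C1c (phi : V -> V) : Prop :=
  (forall i j, (forall x, derivable (compo phi i) x (unitv j)) /\
     continuous (fun x => 'D_(unitv j) (compo phi i) x)) /\
  exists K : set V, compact K /\ forall x, ~ K x -> phi x = 0.

Definition divg (phi : V -> V) : V -> R :=
  fun x => \sum_(i < d) 'D_(unitv i) (compo phi i) x.

Definition unit_bounded (phi : V -> V) : Prop :=
  forall x, \sum_(i < d) (phi x 0 i) ^+ 2 <= 1.

Definition perim (E : set V) : \bar R :=
  ereal_sup [set integ E (divg phi) | phi in [set phi | C1c phi /\ unit_bounded phi]].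

Definition ratio (E : set V) : \bar R := (perim E * ((fine (leb E))^-1)%:E)%E.

Definition cheeger (F : set V) : \bar R :=
  ereal_inf [set ratio E | E in
    [set E | lmeas E /\ null (E `\` F) /\ (0 < leb E)%E]].

Definition Nset (N : nat) (F : set V) (E : 'I_N -> set V) : Prop :=
  (forall i, lmeas (E i) /\ null (E i `\` F) /\ (0 < leb (E i))%E) /\
  (forall i j, i != j -> null (E i `&` E j)).

Definition Ncluster (N : nat) (F : set V) (E : 'I_N -> set V) : Prop :=
  Nset F E /\ forall i, (perim (E i) < +oo)%E.

Definition ratios (N : nat) (E : 'I_N -> set V) : 'rV[R]_N :=
  \row_i fine (ratio (E i)).

Definition HPhi (N : nat) (Phi : 'rV[R]_N -> R) (F : set V) : \bar R :=
  ereal_inf [set (Phi (ratios E))%:E | E in [set E | Ncluster F E]].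

Definition PhiExt (N : nat) (Phi : 'rV[R]_N -> R) (v : 'I_N -> \bar R) : \bar R :=
  if [forall i, v i \is a fin_num] then (Phi (\row_i fine (v i)))%:E else +oo%E.

Definition LPhi (N : nat) (Phi : 'rV[R]_N -> R) (F : set V) : \bar R :=
  ereal_inf [set PhiExt Phi (fun i => cheeger (E i)) | E in [set E | Nset F E]].

End Defs.

Section PhiHyp.
Variables (R : realType) (N : nat) (Phi : 'rV[R]_N -> R).

Definition nonnegv (v : 'rV[R]_N) : Prop := forall i, 0 <= v 0 i.

Definition Phi_nonneg : Prop := forall v, nonnegv v -> 0 <= Phi v.

Definition Phi_lsc : Prop := forall v, nonnegv v -> forall e : R, 0 < e ->
  \forall w \near v, nonnegv w -> Phi v - e < Phi w.

Definition Phi_coercive : Prop := exists2 delta : R, 0 < delta &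
  forall v, nonnegv v -> delta * \sum_(i < N) v 0 i <= Phi v.

Definition Phi_monotone : Prop := forall v w, nonnegv v -> nonnegv w ->
  (forall i, v 0 i <= w 0 i) -> Phi v <= Phi w.
End PhiHyp.

(* Main.v *)
Require Import Defs.
From HB Require Import structures.
From mathcomp Require Import all_boot all_order all_algebra.
From mathcomp Require Import all_classical all_reals all_analysis.
From mathcomp Require Import measurable_realfun ring lra.
Import Order.TTheory GRing.Theory Num.Theory.
Import numFieldNormedType.Exports.
Set Implicit Arguments. Unset Strict Implicit. Unset Printing Implicit Defensive.
Local Open Scope classical_set_scope.
Local Open Scope ring_scope.

(** The direct method, run inside [R^d] with the outer measure [leb].

    Testing the perimeter of [E] with fields [f e_j] and telescoping small
    translations gives [|(E + s e_j) Delta E| <= s P(E)], because [C^1_c]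
    functions approximate indicators in [L^1].  Split a cube dyadically, one
    coordinate at a time: the [L^1] distance from [1_E] to its cell averages
    then drops at each split by an amount that the translation estimate
    controls, and it tends to [0].  Summing the geometric series gives the
    Poincare inequality [sum_Q |E n Q||Q \ E|/|Q| <= c r P(E)] for the grid of
    side [r].  It yields both compactness (up to [O(r)], [E] is one of finitely
    many unions of cells) and a positive lower bound on [|E|] when
    [P(E) <= C |E|], so that no isoperimetric inequality is needed.

    A minimizing sequence of clusters therefore converges in [L^1] along an
    ultrafilter, and lower semicontinuity of the perimeter and of [Phi] makes
    the limit a minimizer.  The case [N = 1], [Phi v = v] provides a Cheeger set
    inside each chamber of any [N]-set, so replacing chambers by their Cheeger
    sets turns an [N]-set into a cluster with the same value: [H <= L], and the
    minimizer for [H] is also one for [L]. *)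

(** * Lebesgue outer measure on R^d *)

(** The danger in the limit is a chamber that vanishes: its ratio would mean nothing. Coercivity of
    [Phi] bounds every ratio of the minimizing sequence, which reads [P(E) <= C |E|]. This single
    bound feeds both compactness, through [P(E) <= C |B|] in a cube [B], and the lower bound on
    volumes.

    Only [P(X i) <= v i |X i|] survives, where [v] is the limit of the ratio vectors: the ratios of
    the limit may be strictly smaller than [v]. Monotonicity of [Phi] absorbs this drop, and lower
    semicontinuity is applied at [v], not at the ratios of [X].

    An ultrafilter makes the [N] chambers and the ratio vector converge at once, with no successive
    or diagonal subsequences; total boundedness then becomes a pigeonhole among finitely many unions
    of cells.

    Everything takes place in dimension [d.+1]. In dimension 0 every box has volume 1, the empty
    product, so each countable cover would have infinite total volume and even [leb set0] would be
    infinite. *)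

Section leb_outer.
Variables (R : realType) (d : nat).
Notation V := 'rV[R]_d.+1.
Implicit Types (E F : set V) (a b x : V).

Lemma boxvol_ge0 a b : 0 <= boxvol a b.
Proof. by apply: prodr_ge0 => i _; rewrite le_max lexx. Qed.

(** Degenerate boxes pad a finite cover to a sequence at no cost. Positive dimension matters: an
    empty product would be 1. *)
Lemma boxvol_id a : boxvol a a = 0.
Proof. by rewrite /boxvol big_ord_recl subrr max_l// mul0r. Qed.

Lemma leb_cover E (a b : nat -> V) : E `<=` \bigcup_k box (a k) (b k) ->
  (leb E <= \sum_(0 <= k <oo) (boxvol (a k) (b k))%:E)%E.
Proof. by move=> EU; apply: ereal_inf_lbound; exists a, b. Qed.

Lemma leb_cover_lt E (c : \bar R) : (leb E < c)%E -> exists a b : nat -> V,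
  E `<=` \bigcup_k box (a k) (b k) /\
  (\sum_(0 <= k <oo) (boxvol (a k) (b k))%:E < c)%E.
Proof. by move=> /ereal_inf_lt [_ [a [b [EU ->]]] ?]; exists a, b. Qed.

Lemma leb_ge0 E : (0 <= leb E)%E.
Proof.
apply: le_ereal_inf_tmp => _ [a [b [_ ->]]].
by apply: nneseries_ge0 => k _ _; rewrite lee_fin boxvol_ge0.
Qed.

Lemma le_leb E F : E `<=` F -> (leb E <= leb F)%E.
Proof.
move=> EF; apply: ereal_inf_le_tmp => _ [a [b [FU ->]]].
by exists a, b; split => //; apply: subset_trans FU.
Qed.

Lemma leb_box_le a b : (leb (box a b) <= (boxvol a b)%:E)%E.
Proof.
pose a' k := if k is 0%N then a else 0 : V.
pose b' k := if k is 0%N then b else 0 : V.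
have /leb_cover/le_trans : box a b `<=` \bigcup_k box (a' k) (b' k).
  by move=> x abx; exists 0%N.
apply; rewrite (nneseries_recl)//; last by move=> k _; rewrite lee_fin boxvol_ge0.
rewrite eseries_cond/= eseries0 ?adde0//= => -[|k]//= _ _.
by rewrite boxvol_id.
Qed.

Lemma leb0 : leb (@set0 V) = 0%E.
Proof.
apply/eqP; rewrite eq_le leb_ge0 andbT.
apply: le_trans (le_trans (le_leb (@sub0set _ (box 0 0))) (leb_box_le _ _)) _.
by rewrite boxvol_id.
Qed.

(** Each [A n] has a cover within [e / 2 ^ n.+1] of optimal, and a bijection of [nat] with
    [nat * nat] lists all these boxes as one cover. A set of infinite measure has no strictly
    near-optimal cover, hence the separate case. *)
Lemma leb_sigma_subadditive : sigma_subadditive (@leb R d.+1).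
Proof.
move=> A; have [[i ioo]|] := pselect (exists i, leb (A i) = +oo%E).
  by rewrite (eseries_pinfty _ _ ioo) ?leey// => n _;
     rewrite -ltNye (lt_le_trans _ (leb_ge0 _)).
rewrite -forallNE => Aoo.
apply/lee_addgt0Pr => _/posnumP[e].
rewrite (le_trans _ (epsilon_trick _ _ _))//; last by move=> n; exact: leb_ge0.
pose P n (G : nat -> V * V) := A n `<=` \bigcup_k box (G k).1 (G k).2 /\
  (\sum_(k <oo) (boxvol (G k).1 (G k).2)%:E <=
    leb (A n) + (e%:num / (2 ^ n.+1)%:R)%:E)%E.
have [G PG] : {G : nat -> nat -> V * V & forall n, P n (G n)}.
  apply: (@choice _ _ P) => n.
  have fA : leb (A n) \is a fin_num.
    by rewrite ge0_fin_numE ?leb_ge0// ltey; apply/eqP; exact: Aoo.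
  have /leb_cover_lt[a [b [AU s]]] :
      (leb (A n) < leb (A n) + (e%:num / (2 ^ n.+1)%:R)%:E)%E.
    by rewrite lteDl// lte_fin.
  by exists (fun k => (a k, b k)); split => //; exact/ltW.
pose mu (p : nat * nat) := (boxvol (G p.1 p.2).1 (G p.1 p.2).2)%:E : \bar R.
have mu0 p : (0 <= mu p)%E by rewrite lee_fin boxvol_ge0.
apply: (@le_trans _ _ (\esum_(i in setT) mu i)).
  have /card_esym/ppcard_eqP[f] := card_nat2.
  apply: (@le_trans _ _ (\sum_(k <oo) mu (f k))%E).
    apply: (@leb_cover _ (fun k => (G (f k).1 (f k).2).1)
                         (fun k => (G (f k).1 (f k).2).2)).
    move=> t [i _ /(PG i).1 [j _ Gt]].
    by exists (f^-1%FUN (i, j)) => //=; rewrite invK ?inE.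
  rewrite -(esum_pred_image mu _ xpredT) ?[fun=> _]set_true//.
  by rewrite image_eq.
rewrite (_ : esum _ _ = \sum_(i <oo) \sum_(j <oo ) mu (i, j))%E; last first.
  pose J : nat -> set (nat * nat) := fun i => [set (i, j) | j in setT].
  rewrite (_ : setT = \bigcup_k J k); last first.
    by rewrite predeqE => -[a b]; split => // _; exists a => //; exists b.
  rewrite esum_bigcupT /=; last 2 first.
    - apply/trivIsetP => i j _ _ ij.
      rewrite predeqE => -[n m] /=; split => //= -[] [_] _ [<-{n} _].
      by move=> [m' _] [] /esym/eqP; rewrite (negbTE ij).
    - by [].
  rewrite -(image_id [set: nat]) -fun_true esum_pred_image//; last first.
    by move=> n _; exact: esum_ge0.
  apply: eq_eseriesr => /= j _.
  rewrite -(esum_pred_image mu (pair j) predT)//=; last first.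
    by move=> ? ? _ _; exact: (@can_inj _ _ _ snd).
  by congr esum; rewrite predeqE => -[a b]; split; move=> [i _ <-]; exists i.
apply: lee_nneseries => [n _ _|n _]; last exact: (PG n).2.
by apply: nneseries_ge0.
Qed.

HB.instance Definition _ := isOuterMeasure.Build R V (@leb R d.+1)
  leb0 leb_ge0 le_leb leb_sigma_subadditive.

End leb_outer.

(** * Volume of boxes and measurability of half-spaces *)

Section leb_box.
Variables (R : realType) (d : nat).
Notation V := 'rV[R]_d.+1.
Implicit Types (E F : set V) (a b x : V) (j : 'I_d.+1).

Definition upd x j t : V := \row_i (if i == j then t else x 0 i).

Lemma updE x j t i : upd x j t 0 i = if i == j then t else x 0 i.
Proof. by rewrite mxE. Qed.

Lemma boxvol_updl a b j t : boxvol (upd a j t) b =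
  Num.max 0 (b 0 j - t) * \prod_(i < d.+1 | i != j) Num.max 0 (b 0 i - a 0 i).
Proof.
rewrite /boxvol (bigD1 j)//= updE eqxx; congr (_ * _).
by apply: eq_bigr => i /negbTE ij; rewrite updE ij.
Qed.

Lemma boxvol_updr a b j t : boxvol a (upd b j t) =
  Num.max 0 (t - a 0 j) * \prod_(i < d.+1 | i != j) Num.max 0 (b 0 i - a 0 i).
Proof.
rewrite /boxvol (bigD1 j)//= updE eqxx; congr (_ * _).
by apply: eq_bigr => i /negbTE ij; rewrite updE ij.
Qed.

(** The two pieces into which the hyperplane [x j = c] cuts a box. If the hyperplane misses the box,
    [min] and [max] make one piece degenerate and the truncation of sides at 0 keeps the
    equality. *)
Lemma boxvol_split a b j c :
  boxvol a (upd b j (Num.min (b 0 j) c)) + boxvol (upd a j (Num.max (a 0 j) c)) b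
  = boxvol a b.
Proof.
rewrite boxvol_updl boxvol_updr -mulrDl /boxvol [RHS](bigD1 j)//=; congr (_ * _).
rewrite /Num.max /Num.min; do ![case: ifPn]; rewrite -?leNgt; lra.
Qed.

(** Factor of coordinate [i] once the coordinates below [m] have been integrated out. The product
    over [i] goes from the indicator of the box, at [m = 0], to its volume, at [m = d.+1]. *)
Let w a b x (m : nat) (i : 'I_d.+1) : R :=
  if (i < m)%N then Num.max 0 (b 0 i - a 0 i) else \1_`[a 0 i, b 0 i] (x 0 i).

Let w_ge0 a b x m i : 0 <= w a b x m i.
Proof. by rewrite /w; case: ifPn => _; rewrite ?le_max ?lexx. Qed.

Let w_upd a b x j t : \prod_i w a b (upd x j t) j i =
  \1_`[a 0 j, b 0 j] t * \prod_(i < d.+1 | i != j) w a b x j.+1 i.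
Proof.
rewrite (bigD1 j)//= {1}/w ltnn updE eqxx; congr (_ * _).
apply: eq_bigr => i ij; rewrite /w updE (negbTE ij) ltnS [in RHS]leq_eqVlt.
by rewrite (_ : (i : nat) == j = false)//; apply/negbTE.
Qed.

Let w_S a b x j : \prod_i w a b x j.+1 i =
  Num.max 0 (b 0 j - a 0 j) * \prod_(i < d.+1 | i != j) w a b x j.+1 i.
Proof. by rewrite (bigD1 j)//= {1}/w ltnSn. Qed.

Let int_w a b x j : (\int[@lebesgue_measure R]_t (\prod_i w a b (upd x j t) j i)%:E =
  (\prod_i w a b x j.+1 i)%:E)%E.
Proof.
under eq_integral do rewrite w_upd EFinM.
rewrite ge0_integralZr//=; last 2 first.
- by apply/measurable_EFinP/measurable_indic.
- by rewrite lee_fin; apply: prodr_ge0 => i _.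
rewrite integral_indic// setIT w_S EFinM; congr (_ * _)%E. 
rewrite [LHS](lebesgue_measure_itv `[a 0 j, b 0 j])/= lte_fin; case: ifPn => [ab|];
  first by rewrite max_r// subr_ge0 ltW.
by rewrite -leNgt => ab; rewrite max_l// subr_le0.
Qed.

(* Integrating the pointwise inequality 1_box <= sum_k 1_(box k) one coordinate
   at a time turns indicators into side lengths. *)
Lemma boxvol_le_cover a b (ak bk : nat -> V) :
  box a b `<=` \bigcup_k box (ak k) (bk k) ->
  ((boxvol a b)%:E <= \sum_(0 <= k <oo) (boxvol (ak k) (bk k))%:E)%E.
Proof.
move=> abU.
have wp_ge0 a' b' x m : (0 <= (\prod_i w a' b' x m i)%:E)%E.
  by rewrite lee_fin; apply: prodr_ge0.
suff H m : (m <= d.+1)%N -> forall x, ((\prod_i w a b x m i)%:E <=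
    \sum_(0 <= k <oo) (\prod_i w (ak k) (bk k) x m i)%:E)%E.
  have wd a' b' : boxvol a' b' = \prod_i w a' b' 0 d.+1 i.
    by apply: eq_bigr => i _; rewrite /w ltn_ord.
  have := H _ (leqnn _) 0; rewrite -wd => /le_trans; apply.
  by apply: lee_nneseries => [k _ _|k _]//; rewrite wd.
elim: m => [_ x|m IH md x].
  have [xab|xab] := pselect (box a b x).
    have [k _ xk] := abU x xab.
    apply: (@le_trans _ _ (\prod_i w (ak k) (bk k) x 0 i)%:E).
      rewrite lee_fin big1; last first.
        by move=> i _; rewrite /w/= indicE mem_set//=; have := xab i; rewrite in_itv.
      rewrite big1// => i _.
      by rewrite /w/= indicE mem_set//=; have := xk i; rewrite in_itv.
    apply: le_trans (nneseries_lim_ge k.+1 _); last by [].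
    by rewrite big_mkord [leRHS]big_ord_recr/= leeDr// sume_ge0.
  rewrite (_ : \prod_i w a b x 0 i = 0); first exact: nneseries_ge0.
  have [i ni] : exists i, ~ (a 0 i <= x 0 i <= b 0 i).
    by apply: contrapT => /forallNP nn; apply: xab => i; apply: contrapT; exact: nn.
  by rewrite (bigD1 i)//= {1}/w/= indicE memNset ?mul0r//=.
have [j jm] : {j : 'I_d.+1 | j = m :> nat} by exists (Ordinal md).
(* Both sides are now integrals over coordinate [j] of the products of level [j]; monotone
   convergence exchanges series and integral, and the induction hypothesis compares the
   integrands. *)
subst m; rewrite -int_w; under eq_eseriesr do rewrite -int_w.
have mw a' b' : measurable_fun setT (fun t => (\prod_i w a' b' (upd x j t) j i)%:E).
  apply/measurable_EFinP; under eq_fun do rewrite w_upd.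
  by apply: measurable_funM => //; exact: measurable_indic.
rewrite -integral_nneseries//; last by move=> n; exact: mw.
apply: ge0_le_integral => //; first exact: mw.
  by apply: ge0_emeasurable_sum => // k _; exact: mw.
by move=> t _; apply: IH; exact: ltnW.
Qed.

Lemma leb_box a b : leb (box a b) = (boxvol a b)%:E.
Proof.
apply/eqP; rewrite eq_le leb_box_le/=.
by apply: le_ereal_inf_tmp => _ [ak [bk [abU ->]]]; exact: boxvol_le_cover.
Qed.

(** Cutting the boxes of a near-optimal cover of the test set [X] along the hyperplane covers both
    parts of [X] at the same total volume. *)
Lemma lmeas_halfspace j c : lmeas [set x : V | x 0 j <= c].
Proof.
apply: le_caratheodory_measurable => X /=.
apply/lee_addgt0Pr => e e0.
have [->|Xfin] := eqVneq (leb X) +oo%E; first by rewrite leey.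
have /leb_cover_lt[a [b [XU s]]] : (leb X < leb X + e%:E)%E.
  by rewrite lteDl ?lte_fin// ge0_fin_numE ?leb_ge0// lt_neqAle Xfin leey.
apply: le_trans (ltW s).
under eq_eseriesr do rewrite -(boxvol_split _ _ j c) EFinD.
rewrite nneseriesD; [|by move=> *; rewrite lee_fin boxvol_ge0..].
apply: leeD; apply: leb_cover => x [/XU [k _ xk] /= xc]; exists k => // i;
  have := xk i; rewrite !updE; case: eqVneq => // -> /andP[ax xb].
  by rewrite ax le_min xb xc.
by rewrite xb ge_max ax ltW// ltNge; apply/negP.
Qed.

End leb_box.

(** * Translation invariance *)

Section translation.
Variables (R : realType) (d : nat).
Notation V := 'rV[R]_d.+1.
Implicit Types (E F : set V) (a b x h : V).

(** This is [E - h], so [E + h] is written [trans (- h) E]. *)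
Definition trans h E : set V := [set x | E (x + h)].

Lemma transK h E : trans (- h) (trans h E) = E.
Proof. by apply/funext => x; rewrite /trans/= subrK. Qed.

Lemma boxvol_shift h a b : boxvol (a - h) (b - h) = boxvol a b.
Proof.
by apply: eq_bigr => i _; rewrite !mxE; congr (Num.max _ _); ring.
Qed.

Lemma leb_trans h E : leb (trans h E) = leb E.
Proof.
have H g (F : set V) : (leb (trans g F) <= leb F)%E.
  apply: le_ereal_inf_tmp => _ [a [b [FU ->]]].
  rewrite (_ : (\sum_(0 <= k <oo) _)%E =
    (\sum_(0 <= k <oo) (boxvol (a k - g) (b k - g))%:E)%E); last first.
    by apply: eq_eseriesr => k _; rewrite boxvol_shift.
  apply: leb_cover => x /FU [k _ xk]; exists k => // i.
  by have := xk i; rewrite !mxE lerBlDr lerBrDr.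
apply/eqP; rewrite eq_le H/= -{1}(transK h E); exact: H.
Qed.

Lemma lmeas_trans h E : lmeas E -> lmeas (trans h E).
Proof.
move=> mE X; have := mE (trans (- h) X).
by rewrite leb_trans => ->; congr (_ + _)%E;
   rewrite -[RHS](leb_trans (- h)); congr leb;
   rewrite /trans; apply/funext => x/=; rewrite subrK.
Qed.

End translation.

Section rv_norm.
Variables (R : realType) (d : nat).
Implicit Types (x : 'rV[R]_d).

Lemma coord_le_norm x i : `|x 0 i| <= `|x|.
Proof.
rewrite [leRHS]/Num.Def.normr /= mx_normrE.
by apply: (le_bigmax _ (fun k : 'I_1 * 'I_d => `|x k.1 k.2|) (0, i)).
Qed.

Lemma rv_norm_le x e : 0 <= e -> (forall i, `|x 0 i| <= e) -> `|x| <= e.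
Proof.
move=> e0 H; rewrite [leLHS]/Num.Def.normr /= mx_normrE;
  apply: bigmax_le => //= -[k i] _.
by rewrite ord1; exact: H.
Qed.

End rv_norm.

(** * Measurable sets and the layer-cake formula *)

Section leb_measurable.
Variables (R : realType) (d : nat).
Notation V := 'rV[R]_d.+1.
Notation T := (caratheodory_type (@leb R d.+1)).
Implicit Types (E F : set V) (a b x : V) (j : 'I_d.+1).

Lemma lmeasE E : lmeas E = measurable (E : set T).
Proof. by []. Qed.

HB.instance Definition _ := isMeasure.Build _ T R (@leb R d.+1 : set T -> \bar R)
  (@caratheodory_measure0 R V (@leb R d.+1)) (@caratheodory_measure_ge0 R V (@leb R d.+1))
  (@caratheodory_measure_sigma_additive R V (@leb R d.+1)).

Definition lebm : {measure set T -> \bar R} :=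
  [the measure _ _ of (@leb R d.+1 : set T -> \bar R)].

Lemma measurable_coord j : measurable_fun setT (fun x : T => (x : V) 0 j).
Proof.
move=> mD; apply: (measurability _ (RGenOInfty.measurableE R)) => //.
move=> _ [_ [c ->] <-]; rewrite setTI.
rewrite (_ : _ @^-1` _ = ~` [set x : V | x 0 j <= c]).
  by apply: measurableC; exact: lmeas_halfspace.
apply/seteqP; split => x /=; rewrite in_itv/= andbT ltNge; first by move/negP.
by move=> /negP.
Qed.

Lemma lmeas_box a b : lmeas (box a b).
Proof.
rewrite (_ : box a b = \bigcap_(i in [set: 'I_d.+1]) [set x : V | a 0 i <= x 0 i <=
  b 0 i]).
  rewrite lmeasE; apply: fin_bigcap_measurable => // i _.
  rewrite -[X in measurable X]setTI.
  rewrite (_ : [set x : V | _] = (fun x : T => (x : V) 0 i) @^-1` `[a 0 i, b 0 i]).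
    exact: measurable_coord.
  by apply/seteqP; split => x /=; rewrite in_itv.
by apply/seteqP; split => [x H i _|x H i]; exact: H.
Qed.

(** An open set is the union of the boxes with rational center and radius [1 / (n + 1)] that it
    contains; replacing the others by [set0] keeps the index type countable. *)
Lemma lmeas_open E : open E -> lmeas E.
Proof.
move=> oE.
pose B (p : 'rV[rat]_d.+1 * nat) : set V :=
  box (\row_i (ratr (p.1 0 i) - p.2.+1%:R^-1)) (\row_i (ratr (p.1 0 i) + p.2.+1%:R^-1)).
pose G p := if `[< B p `<=` E >] then B p else set0.
rewrite (_ : E = \bigcup_p G p).
  rewrite lmeasE; apply: countable_bigcupT_measurable => [//|p].
  by rewrite /G; case: ifPn => _; [exact: lmeas_box|exact: measurable0].
apply/seteqP; split => [x Ex|x [p _]]; last first.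
  by rewrite /G; case: ifPn => // /asboolP; exact.
have /nbhs_ballP[e /= e0 xeE] : nbhs x E by exact: open_nbhs_nbhs.
have [n ne] : exists n : nat, n.+1%:R^-1 < e / 2.
  have /ltr_add_invr[k] : 0 < e / 2 by rewrite divr_gt0.
  by rewrite add0r => ?; exists k.
have n0 : 0 < n.+1%:R^-1 :> R by rewrite invr_gt0.
have /choice[q qx] : forall i, exists q : rat, `|x 0 i - ratr q| < n.+1%:R^-1.
  move=> i; have /rat_in_itvoo[q] : x 0 i < x 0 i + n.+1%:R^-1 by rewrite ltrDl.
  rewrite in_itv/= => /andP[q1 q2]; exists q.
  by rewrite distrC ger0_norm ?subr_ge0 ?(ltW q1)// ltrBlDl.
pose Q : 'rV[rat]_d.+1 := \row_i q i.
exists (Q, n) => //; rewrite /G.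
have Bx : B (Q, n) x.
  by move=> i; rewrite !mxE/= -ler_distl; exact/ltW/qx.
rewrite (_ : `[< _ >] = true)//; apply/asboolP => y yB; apply: xeE.
rewrite -ball_normE/=; apply: le_lt_trans (_ : `|x - y| <= 2 * n.+1%:R^-1) _;
  last by rewrite mulrC -ltr_pdivlMr.
apply: rv_norm_le => [|i]; first by rewrite mulr_ge0// ltW.
have := yB i; have := Bx i; rewrite !mxE/= -!ler_distl => u v.
apply: (le_trans (ler_distD (ratr (q i)) _ _)).
by rewrite (mulrDl 1 1) mul1r; apply: lerD => //; rewrite distrC.
Qed.

Lemma continuous_lebm_measurable (g : V -> R) : continuous g ->
  measurable_fun setT (g : T -> R).
Proof.
move=> cg mD; apply: (measurability _ (RGenOInfty.measurableE R)) => //.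
move=> _ [_ [c ->] <-]; rewrite setTI; apply: lmeas_open.
by apply: open_comp => [x _|]; [exact: cg|exact: interval_open].
Qed.

Lemma lebm_sigma_finite : sigma_finite setT (@leb R d.+1 : set T -> \bar R).
Proof.
exists (fun n => box (const_mx (- n%:R)) (const_mx n%:R) : set V).
  apply/seteqP; split => // x _.
  exists (Num.bound `|x|) => // i; rewrite !mxE -ler_norml.
  by apply: le_trans (coord_le_norm _ _) _; exact/ltW/archi_boundP.
by move=> n; split; [exact: lmeas_box|rewrite leb_box ltry].
Qed.

HB.instance Definition _ := @Measure_isSigmaFinite.Build _ T R
  (@leb R d.+1 : set T -> \bar R) lebm_sigma_finite.

(** Tonelli for the indicator [f] of the region [x] in [E], [0 <= t < g x]: its slices have measure
    [leb (E n {t < g})] for fixed [t] and length [max (g x) 0] for fixed [x] in [E]. *)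
Lemma layer_cake E (g : V -> R) : lmeas E -> measurable_fun setT (g : T -> R) ->
  (\int[@lebesgue_measure R]_(t in `[0%R, +oo[) leb (E `&` [set x | (t < g x)%R]) =
   \int[lebm]_(x in (E : set T)) (Num.max (g x) 0)%:E)%E.
Proof.
move=> mE mg.
pose f (p : T * (measurableTypeR R)) : \bar R :=
  ((\1_E p.1 * \1_`[0, +oo[ p.2) * (p.2 < g p.1)%R%:R)%:E.
have f0 p : (0 <= f p)%E by rewrite lee_fin !mulr_ge0.
have mf : measurable_fun setT f.
  apply/measurable_EFinP; apply: measurable_funM; first apply: measurable_funM.
  - by apply: (@measurableT_comp _ _ _ _ _ _ (\1_E : T -> R)) => //;
    exact: measurable_indic.
  - apply: (@measurableT_comp _ _ _ _ _ _ (\1_`[0%R, +oo[ : measurableTypeR R -> R)) => //.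
  - apply: (@measurableT_comp _ _ _ _ _ _ (fun b : bool => b%:R : R)) => //.
    apply: measurable_fun_ltr => //.
    by apply: (@measurableT_comp _ _ _ _ _ _ (g : T -> R)).
have := @fubini_tonelli _ _ T (measurableTypeR R) R
  [the sigma_finite_measure _ _ of (@leb R d.+1 : set T -> \bar R)]
  [the sigma_finite_measure _ _ of @lebesgue_measure R] f mf f0.
move=> H; transitivity (\int[@lebesgue_measure R]_y \int[lebm]_x f (x, y))%E.
  rewrite integral_mkcond; apply: eq_integral => t _.
  rewrite patchE; case: ifPn => [|] t0; last first.
    by rewrite integral0_eq// => x _;
      rewrite /f/= (indicE _ _ t) (negbTE t0) mulr0 mul0r.
  transitivity (\int[lebm]_x (\1_(E `&` [set x | t < g x]) (x : V))%:E)%E; last first.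
    apply: eq_integral => x _; rewrite /f/= (indicE _ _ t) t0 mulr1 indicI/=;
      congr (_ * _)%:E.
    by rewrite indicE; congr ((nat_of_bool _)%:R); apply/idP/idP; rewrite inE.
  rewrite integral_indic ?setIT//; apply: measurableI => //.
  rewrite -[X in measurable X]setTI.
  rewrite (_ : [set x : V | _] = (g : T -> R) @^-1` `]t, +oo[); first exact: mg.
  by apply/seteqP; split => x /=; rewrite in_itv/= andbT.
rewrite -H [RHS]integral_mkcond; apply: eq_integral => x _; rewrite patchE.
case: ifPn => xE; last first.
  by rewrite integral0_eq// => t _; rewrite /f/= (indicE _ _ x) (negbTE xE) !mul0r.
transitivity (\int[@lebesgue_measure R]_t (\1_`[0, g x[ t)%:E)%E.
  apply: eq_integral => t _; rewrite /f/= (indicE _ _ x) xE mul1r !indicE -natrM mulnb.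
  suff -> : (t \in `[0, g x[%classic) = (t \in `[0, +oo[%classic) && (t < g x) by [].
  apply/idP/andP => [|[]]; rewrite ?inE/= ?in_itv/= ?andbT; last by move=> -> ->.
  by move=> /andP[]; rewrite ?inE/= ?in_itv/= ?andbT.
rewrite integral_indic// setIT [LHS](lebesgue_measure_itv `[0, g x[)/= lte_fin.
by case: ltP => ?; rewrite ?oppr0 ?adde0 ?EFinN ?sube0.
Qed.

(** The two terms of [integ] are layer cakes of the positive and negative parts of [g]. From here on
    the theory of the Lebesgue integral applies to [perim]. *)
Lemma integE E (g : V -> R) : lmeas E -> measurable_fun setT (g : T -> R) ->
  integ E g = (\int[lebm]_(x in (E : set T)) (g x)%:E)%E.
Proof.
move=> mE mg; rewrite /integ [RHS]integralE layer_cake//; congr (_ - _)%E.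
  by apply: eq_integral => x _; rewrite funeposE EFin_max.
transitivity (\int[lebm]_(x in (E : set T)) (Num.max (- g x) 0)%:E)%E; last first.
  by apply: eq_integral => x _; rewrite funenegE EFin_max.
rewrite -(@layer_cake E (fun x => - g x))//; last exact: measurableT_comp.
by apply: eq_integral => t _; congr (leb (_ `&` _)); apply/funext => x /=;
  rewrite ltrNr.
Qed.

End leb_measurable.

(** * Compactly supported C^1 functions *)

Section unif_cont.
Variables (R : realType) (d : nat).
Notation V := 'rV[R]_d.
Implicit Types (x y v : V) (f g : V -> R).

Lemma norm_unitvZ j (c : R) : `|c *: (unitv R j : V)| <= `|c|.
Proof.
apply: rv_norm_le => // i; rewrite !mxE eqxx/= normrM.
by case: (i == j); rewrite ?normr1 ?normr0 ?mulr1 ?mulr0.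
Qed.

Lemma closed_ball_rv_compact (M : R) : compact [set x : V | `|x| <= M].
Proof.
apply: bounded_closed_compact.
  by exists M; split => [|r Mr x /= xM]; rewrite ?num_real//;
    apply: le_trans xM (ltW Mr).
rewrite (_ : [set x : V | _] = Num.norm @^-1` [set t : R | t <= M])//.
by apply: closed_comp => [x _|]; [exact: norm_continuous|exact: closed_le].
Qed.

Definition bdsupp (f : V -> R) := exists M, forall x, M < `|x| -> f x = 0.

Lemma compact_bdsupp (K : set V) f : compact K -> (forall x, ~ K x -> f x = 0) ->
  bdsupp f.
Proof.
move=> /compact_bounded[N [_ HN]] fK; exists (N + 1) => x Nx; apply: fK => Kx.
by have /= := HN (N + 1) (ltr_pwDr ltr01 (lexx N)) x Kx; rewrite leNgt Nx.
Qed.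

Lemma bdsupp_derive f v : bdsupp f -> bdsupp ('D_v f).
Proof.
move=> [M fM]; exists M => x Mx.
rewrite (@near_eq_derive _ _ _ f (cst 0)) ?derive_cst//.
have : open [set y : V | M < `|y|].
  rewrite (_ : [set y : V | _] = Num.norm @^-1` [set t : R | M < t])//.
  by apply: open_comp => [y _|]; [exact: norm_continuous|exact: open_gt].
move=> oM; have : nbhs x [set y : V | M < `|y|] by exact: open_nbhs_nbhs.
by apply: filterS => y; exact: fM.
Qed.

Lemma bdsupp_bounded f : continuous f -> bdsupp f ->
  exists2 C, 0 < C & forall x, `|f x| <= C.
Proof.
move=> cf [M fM].
have cK := @closed_ball_rv_compact M.
have : compact (f @` [set x : V | `|x| <= M]).
  by apply: continuous_compact => //; exact: continuous_subspaceT.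
move=> /compact_bounded[N [_ HN]]; exists (`|N| + 1); first by rewrite ltr_wpDl.
move=> x; have [xM|xM] := leP `|x| M; last by rewrite fM// normr0 addr_ge0.
apply: (HN (`|N| + 1)); last by exists x.
by rewrite (le_lt_trans (ler_norm N))// ltrDl.
Qed.

(** Heine-Cantor, with compactness used as a near-covering property in the parameter [r] tending to
    0 from the right. *)
Lemma bdsupp_unif_cont f : continuous f -> bdsupp f -> forall e, 0 < e ->
  exists2 r, 0 < r & forall x y, `|x - y| < r -> `|f x - f y| < e.
Proof.
move=> cf [M fM] e e0.
have /compact_near_coveringP ncv := @closed_ball_rv_compact (M + 1).
have := ncv _ (0 : R)^'+ (fun r x => forall y, `|x - y| < r -> `|f x - f y| < e) _.
case.
  move=> x _.
  have e20 : 0 < e / 2 by rewrite divr_gt0.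
  have /cvgr_dist_lt/(_ _ e20)/nbhs_ballP[r /= r0 xr] := cf x.
  exists (ball x (r / 2), [set s | 0 < s < r / 2]).
    split; first by apply: nbhsx_ballx; rewrite divr_gt0.
    have r20 : 0 < r / 2 by rewrite divr_gt0.
    near=> s; apply/andP; split; near: s.
      exact: nbhs_right_gt.
    exact: nbhs_right_lt.
  move=> [x' s]/=; rewrite -ball_normE/= => -[xx' /andP[s0 sr]] y x'y.
  have H z : `|x - z| < r -> `|f x - f z| < e / 2 by move=> ?; apply: xr;
    rewrite -ball_normE.
  have Hx' : `|f x - f x'| < e / 2 by apply: H;
    rewrite (lt_trans xx')// gtr_pMr// invf_lt1// ltr1n.
  have Hy : `|f x - f y| < e / 2.
    apply: H; rewrite (le_lt_trans (ler_distD x' _ _))// [ltRHS](splitr r) ltrD//.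
    exact: lt_trans sr.
  rewrite (le_lt_trans (ler_distD (f x) _ _))// [ltRHS](splitr e) ltrD//.
  by rewrite distrC.
move=> r /= r0 Hr.
(* With [s <= 1], a point outside the ball of radius [M + 1] has its neighbor outside the ball of
   radius [M], where [f] vanishes too. *)
pose s := Num.min (r / 2) 1.
have s0 : 0 < s by rewrite lt_min divr_gt0/=.
exists s => // x y xys.
have [xM|xM] := leP `|x| (M + 1).
  apply: (Hr (r / 2)) => //; [|by rewrite divr_gt0|].
    by rewrite /= sub0r normrN ger0_norm ?divr_ge0 ?ltW// gtr_pMr// invf_lt1// ltr1n.
  by rewrite (lt_le_trans xys)// ge_min lexx.
have yM : M < `|y|.
  have : `|x| <= `|y| + `|x - y| by rewrite -{1}(subrK y x) addrC ler_normD.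
  have : `|x - y| < 1 by rewrite (lt_le_trans xys)// ge_min lexx orbT.
  by lra.
by rewrite !fM ?subrr ?normr0//; lra.
Unshelve. all: by end_near. Qed.

End unif_cont.

(** * Directional derivatives *)

Section directional.
Variables (R : realType) (d : nat).
Notation V := 'rV[R]_d.
Implicit Types (x y v : V) (f g : V -> R).

Lemma line_is_derive f v x (t : R) : (forall y, derivable f y v) ->
  is_derive t 1 (fun s : R => f (x + s *: v)) ('D_v f (x + t *: v)).
Proof.
move=> df.
have E : (fun h : R => h^-1 *: (((fun s : R => f (x + s *: v)) \o shift t) (h *: 1) - f (x + t *: v)))
  = (fun h => h^-1 *: ((f \o shift (x + t *: v)) (h *: v) - f (x + t *: v))).
  apply/funext => h /=; congr (_ *: (f _ - _)).
  by rewrite [h%:A]mulr1 scalerDl addrCA.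
split; first by rewrite /derivable E; exact: df.
by rewrite /derive E.
Qed.

Lemma line_MVT f v x (s : R) : (forall y, derivable f y v) -> 0 < s ->
  exists c, 0 < c < s /\ f (x + s *: v) - f x = 'D_v f (x + c *: v) * s.
Proof.
move=> df s0.
have H t := line_is_derive x t df.
have [|c] := @MVT R (fun s : R => f (x + s *: v)) (fun t => 'D_v f (x + t *: v)) 0 s s0 (fun t _ => H t).
  apply: continuous_subspaceT => t; apply: differentiable_continuous.
  by apply/derivable1_diffP; have [] := H t.
rewrite in_itv/= => cs E; exists c; split => //; move: E.
by rewrite scale0r addr0 subr0.
Qed.

Lemma line_lipschitz f v (C : R) x (s : R) : (forall y, derivable f y v) ->
  (forall y, `|'D_v f y| <= C) -> `|f (x + s *: v) - f x| <= C * `|s|.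
Proof.
move=> df HC.
have H y r : 0 < r -> `|f (y + r *: v) - f y| <= C * r.
  move=> r0; have [c [_ ->]] := line_MVT y df r0.
  by rewrite normrM (gtr0_norm r0) ler_wpM2r// ltW.
have [s0|s0|->] := ltgtP s 0; last by rewrite scale0r addr0 subrr !normr0 mulr0.
  have := H (x + s *: v) (- s); rewrite oppr_gt0 => /(_ s0).
  by rewrite scaleNr addrK distrC (ltr0_norm s0).
by rewrite (gtr0_norm s0); exact: H.
Qed.

(** The mean value theorem turns the remainder into an oscillation of the derivative, which is
    uniformly continuous. Uniformity in [x] is what allows integrating the expansion over a set. *)
Lemma line_expand f j (e : R) : (forall y, derivable f y (unitv R j)) ->
  continuous ('D_(unitv R j) f) -> bdsupp f -> 0 < e ->
  exists2 r, 0 < r & forall x (s : R), 0 < s < r ->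
    `|f (x + s *: unitv R j) - f x - s * 'D_(unitv R j) f x| <= e * s.
Proof.
move=> df cf bf e0.
have [r r0 Hr] := bdsupp_unif_cont cf (bdsupp_derive (unitv R j) bf) e0.
exists r => // x s /andP[s0 sr].
have [c [/andP[c0 cs] ->]] := line_MVT x df s0.
rewrite mulrC -mulrBr normrM (gtr0_norm s0) mulrC ler_wpM2r ?ltW//.
apply: Hr; rewrite addrC addKr; apply: le_lt_trans (norm_unitvZ _ _) _.
by rewrite gtr0_norm// (lt_trans cs).
Qed.

Definition sC1c f := (forall j, (forall x, derivable f x (unitv R j)) /\
  continuous ('D_(unitv R j) f)) /\ bdsupp f.

(** [sC1c] constrains partial derivatives only; they are bounded, so moving one coordinate at a time
    gives a Lipschitz estimate. *)
Lemma sC1c_continuous f : sC1c f -> continuous f.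
Proof.
move=> [df bf].
have /choice[C HC] : forall j, exists C, 0 < C /\ forall x, `|'D_(unitv R j) f x| <= C.
  move=> j; have [C C0 HC] := bdsupp_bounded (df j).2 (bdsupp_derive (unitv R j) bf).
  by exists C.
(* A path from [x] to [y] along coordinate directions, over which [f y - f x] telescopes. *)
pose z x y (k : nat) : V := \row_i (if (i < k)%N then y 0 i else x 0 i).
have zS x y (k : 'I_d) : z x y k.+1 = z x y k + (y 0 k - x 0 k) *: unitv R k.
  apply/rowP => i; rewrite !mxE eqxx/=; case: (eqVneq i k) => [->|ik].
    by rewrite ltnS leqnn ltnn mulr1 addrC subrK.
  by rewrite mulr0 addr0 ltnS leq_eqVlt (_ : (i == k :> nat) = false)//; apply/negbTE.
have lip x y : `|f y - f x| <= (\sum_j C j) * `|y - x|.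
  have -> : f y - f x = \sum_(j < d) (f (z x y j.+1) - f (z x y j)).
    rewrite -(big_mkord xpredT (fun j => f (z x y j.+1) - f (z x y j))) telescope_sumr//.
    by congr (f _ - f _); apply/rowP => i; rewrite mxE ?ltn_ord.
  rewrite mulr_suml; apply: le_trans (ler_norm_sum _ _ _) _; apply: ler_sum => j _.
  rewrite zS; apply: le_trans (line_lipschitz _ _ (df j).1 (HC j).2) _.
  apply: ler_wpM2l; first exact/ltW/(HC j).1.
  by have := coord_le_norm (y - x) j; rewrite !mxE.
have C0 : 0 <= \sum_j C j by apply: sumr_ge0 => j _; rewrite ltW ?(HC j).1.
move=> x A /nbhs_ballP[e /= e0 eA].
have C10 : 0 < \sum_j C j + 1 by rewrite ltr_wpDl.
apply/nbhs_ballP; exists (e / (\sum_j C j + 1)); first exact: divr_gt0.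
move=> y; rewrite -ball_normE/= => xy; apply: eA; rewrite -ball_normE/=.
rewrite distrC; apply: le_lt_trans (lip _ _) _.
apply: (@le_lt_trans _ _ ((\sum_j C j + 1) * `|y - x|)).
  by rewrite ler_wpM2r// lerDl.
by rewrite mulrC -ltr_pdivlMr// distrC.
Qed.

Lemma sC1c_derive_bounded f j : sC1c f ->
  exists2 C, 0 < C & forall x, `|'D_(unitv R j) f x| <= C.
Proof. by move=> [df bf]; apply: bdsupp_bounded (df j).2 (bdsupp_derive _ bf). Qed.

Lemma C1c_compo (phi : V -> V) i : C1c phi -> sC1c (compo phi i).
Proof.
move=> [dphi [K [cK phiK]]]; split=> [j|]; first exact: dphi.
by apply: compact_bdsupp cK _ => x /phiK; rewrite /compo => ->; rewrite mxE.
Qed.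

End directional.

(** * Volume and integral over sets of finite measure *)

Section vol.
Variables (R : realType) (d : nat).
Notation V := 'rV[R]_d.+1.
Notation T := (caratheodory_type (@leb R d.+1)).
Implicit Types (E F A B : set V) (h : V) (f g : V -> R).

Definition mfin E := lmeas E /\ (leb E < +oo)%E.
(** Takes the default value 0 on sets of infinite measure, hence the recurring hypothesis [mfin]. *)
Definition vol E : R := fine (leb E).

Lemma lebE E : mfin E -> leb E = (vol E)%:E.
Proof. by move=> [_ Ey]; rewrite fineK// ge0_fin_numE// leb_ge0. Qed.

Lemma vol_ge0 E : 0 <= vol E. Proof. by rewrite fine_ge0// leb_ge0. Qed.

Lemma mfin_sub E F : mfin F -> lmeas E -> E `<=` F -> mfin E.
Proof. by move=> [_ Fy] mE EF; split => //; apply: le_lt_trans Fy; exact: le_leb. Qed.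

Lemma mfinI E F : mfin E -> lmeas F -> mfin (E `&` F).
Proof.
by move=> mE mF; apply: (mfin_sub mE) => //; apply: (@measurableI _ T) => //;
  exact: mE.1.
Qed.

Lemma mfinD E F : mfin E -> lmeas F -> mfin (E `\` F).
Proof.
by move=> mE mF; apply: (mfin_sub mE) => [|x []//]; apply: (@measurableD _ T) => //;
  exact: mE.1.
Qed.

Lemma mfinU E F : mfin E -> mfin F -> mfin (E `|` F).
Proof.
move=> mE mF; split; first by apply: (@measurableU _ T); [exact: mE.1|exact: mF.1].
by apply: le_lt_trans (outer_measureU2 _ _ _) _; rewrite lte_add_pinfty ?mE.2 ?mF.2.
Qed.

Lemma mfinY E F : mfin E -> mfin F -> mfin (E `+` F).
Proof. by move=> mE mF; apply: mfinU; [apply: mfinD mF.1|apply: mfinD mE.1]. Qed.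

Lemma mfin_box (a b : V) : mfin (box a b).
Proof. by split; [exact: lmeas_box|rewrite leb_box ltry]. Qed.

Lemma mfin_trans h E : mfin E -> mfin (trans h E).
Proof. by move=> mE; split; [exact: lmeas_trans mE.1|rewrite leb_trans mE.2]. Qed.

Lemma vol_trans h E : vol (trans h E) = vol E.
Proof. by rewrite /vol leb_trans. Qed.

Lemma vol_le E F : mfin F -> E `<=` F -> vol E <= vol F.
Proof.
move=> mF EF; rewrite fine_le//; last exact: le_leb.
  rewrite ge0_fin_numE ?leb_ge0//; apply: le_lt_trans mF.2; exact: le_leb.
by rewrite ge0_fin_numE ?leb_ge0// mF.2.
Qed.

Lemma volU E F : mfin E -> mfin F -> [disjoint E & F] ->
  vol (E `|` F) = vol E + vol F.
Proof.
move=> mE mF EF; apply: EFin_inj.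
rewrite EFinD -!lebE//; last exact: mfinU.
by apply: (@measureU _ _ T (@lebm R d)); [exact: mE.1|exact: mF.1|exact/eqP].
Qed.

Lemma volU_le E F : mfin E -> mfin F -> vol (E `|` F) <= vol E + vol F.
Proof.
move=> mE mF; rewrite -lee_fin EFinD -!lebE//; last exact: mfinU.
exact: outer_measureU2.
Qed.

Lemma volDI E F : mfin E -> lmeas F -> vol E = vol (E `\` F) + vol (E `&` F).
Proof.
move=> mE mF; rewrite -volU ?setUIDK//; [|exact: mfinD|exact: mfinI|].
  by rewrite setUC setUIDK.
by apply/eqP; rewrite -subset0 => x [[_ ?] []].
Qed.

Lemma volY E F : mfin E -> mfin F -> vol (E `+` F) = vol (E `\` F) + vol (F `\` E).
Proof.
move=> mE mF; rewrite volU//; [exact: mfinD mF.1|exact: mfinD mE.1|].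
by apply/eqP; rewrite -subset0 => x [[_ ?] []].
Qed.

Lemma volY_triangle E F G : mfin E -> mfin F -> mfin G ->
  vol (E `+` G) <= vol (E `+` F) + vol (F `+` G).
Proof.
move=> mE mF mG; apply: le_trans (volU_le (mfinY mE mF) (mfinY mF mG)).
apply: vol_le; first by apply: mfinU; exact: mfinY.
move=> x [[Ex Gx]|[Gx Ex]]; have [Fx|Fx] := pselect (F x).
- by right; left.
- by left; left.
- by left; right.
- by right; right.
Qed.

Lemma vol_diff_le E F : mfin E -> mfin F -> `|vol E - vol F| <= vol (E `+` F).
Proof.
move=> mE mF; rewrite volY// (volDI mE mF.1) (volDI mF mE.1) (setIC F E).
have := vol_ge0 (E `\` F); have := vol_ge0 (F `\` E).
by rewrite ler_norml => *; apply/andP; split; lra.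
Qed.

End vol.

Section iint.
Variables (R : realType) (d : nat).
Notation V := 'rV[R]_d.+1.
Notation T := (caratheodory_type (@leb R d.+1)).
Implicit Types (E F A B : set V) (h : V) (f g : V -> R).

(** These functions are integrable over every set of finite measure, so linearity of [iint] comes
    without further integrability conditions; derivatives of test functions belong to the class. *)
Definition bcont g := continuous g /\ exists C, forall x, `|g x| <= C.

Definition iint E g : R := fine (\int[@lebm R d]_(x in (E : set T)) (g x)%:E)%E.

Lemma bcont_cst c : bcont (fun=> c).
Proof. by split; [exact: cst_continuous|exists `|c|]. Qed.

Lemma bcontD f g : bcont f -> bcont g -> bcont (fun x => f x + g x).
Proof.
move=> [cf [C fC]] [cg [D gD]]; split.
  by move=> x; apply: continuousD; [exact: cf|exact: cg].
by exists (C + D) => x; apply: le_trans (ler_normD _ _) _; apply: lerD.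
Qed.

Lemma bcontZ c f : bcont f -> bcont (fun x => c * f x).
Proof.
move=> [cf [C fC]]; split.
  by move=> x; apply: continuousM; [exact: cst_continuous|exact: cf].
by exists (`|c| * C) => x; rewrite normrM ler_wpM2l.
Qed.

Lemma bcontB f g : bcont f -> bcont g -> bcont (fun x => f x - g x).
Proof.
move=> cf cg; rewrite (_ : (fun _ => _) = fun x => f x + (-1) * g x).
  exact/bcontD/bcontZ.
by apply/funext => x; rewrite mulN1r.
Qed.

Lemma bcont_sum (I : finType) (f : I -> V -> R) : (forall i, bcont (f i)) ->
  bcont (fun x => \sum_i f i x).
Proof.
move=> cf; rewrite (_ : (fun x => _) = \sum_i f i); last first.
  by apply/funext => x; rewrite fct_sumE.
elim/big_ind : _ => //; first exact: (bcont_cst 0).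
by move=> u v cu cv; exact: bcontD.
Qed.

Lemma bcont_shift h f : bcont f -> bcont (fun x => f (x + h)).
Proof.
move=> [cf [C fC]]; split; last by exists C.
move=> x; apply: (@continuous_comp _ _ _ (fun x : V => x + h) f); last exact: cf.
by apply: continuousD; [exact: cvg_id|exact: cst_continuous].
Qed.

Lemma bcont_integrable E g : mfin E -> bcont g ->
  (@lebm R d).-integrable (E : set T) (EFin \o (g : T -> R)).
Proof.
move=> [mE Ey] [cg [C gC]]; apply: measurable_bounded_integrable => //.
  by apply: measurable_funTS; exact: continuous_lebm_measurable.
exists C; split; first by rewrite num_real.
by move=> M CM x _ /=; rewrite (le_trans (gC x))// ltW.
Qed.

Lemma integ_iint E g : mfin E -> bcont g -> integ E g = (iint E g)%:E.
Proof.
move=> mE cg; rewrite integE; [|exact: mE.1|exact: continuous_lebm_measurable cg.1].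
rewrite /iint fineK//; apply: integrable_fin_num; first exact: mE.1.
exact: bcont_integrable.
Qed.

Lemma iintD E f g : mfin E -> bcont f -> bcont g ->
  iint E (fun x => f x + g x) = iint E f + iint E g.
Proof.
move=> mE cf cg.
exact: (@RintegralD _ T R (@lebm R d) E f g mE.1 (bcont_integrable mE cf) (bcont_integrable mE cg)).
Qed.

Lemma iintB E f g : mfin E -> bcont f -> bcont g ->
  iint E (fun x => f x - g x) = iint E f - iint E g.
Proof.
move=> mE cf cg.
exact: (@RintegralB _ T R (@lebm R d) E f g mE.1 (bcont_integrable mE cf) (bcont_integrable mE cg)).
Qed.

Lemma iintZ E c f : mfin E -> bcont f -> iint E (fun x => c * f x) = c * iint E f.
Proof.
move=> mE cf.
exact: (@RintegralZl _ T R (@lebm R d) E f c mE.1 (bcont_integrable mE cf)).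
Qed.

Lemma iint_sum E (I : finType) (f : I -> V -> R) : mfin E -> (forall i, bcont (f i)) ->
  iint E (fun x => \sum_i f i x) = \sum_i iint E (f i).
Proof.
move=> mE cf.
suff [] : iint E (fun x => \sum_(i <- enum I) f i x) = \sum_(i <- enum I) iint E (f i) /\
    bcont (fun x => \sum_(i <- enum I) f i x).
  by rewrite big_enum/= => <- _; congr (iint E _); apply/funext => x; rewrite big_enum.
elim: (enum I) => [|i s [IH cs]].
  rewrite big_nil; split; last first.
    by rewrite (_ : (fun _ => _) = fun=> 0); [exact: bcont_cst|apply/funext => x;
      rewrite big_nil].
  rewrite /iint integral0_eq// => x _; by rewrite big_nil.
rewrite big_cons -IH -iintD//.
rewrite (_ : (fun x : V => \sum_(j <- _) _) = fun x => f i x + \sum_(j <- s) f j x).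
  by split => //; exact: bcontD.
by apply/funext => x; rewrite big_cons.
Qed.

Lemma iint_cst E c : mfin E -> iint E (fun=> c) = c * vol E.
Proof. by move=> mE; exact: (@Rintegral_cst _ T R (@lebm R d) E mE.1). Qed.

Lemma iint_le E f g : mfin E -> bcont f -> bcont g ->
  (forall x, E x -> f x <= g x) -> iint E f <= iint E g.
Proof.
move=> mE cf cg.
exact: (@le_Rintegral _ T R (@lebm R d) E f g mE.1 (bcont_integrable mE cf) (bcont_integrable mE cg)).
Qed.

Lemma iint_ge0 E f : mfin E -> bcont f -> (forall x, E x -> 0 <= f x) -> 0 <= iint E f.
Proof.
move=> mE cf f0; have := iint_le mE (bcont_cst 0) cf f0.
by rewrite iint_cst// mul0r.
Qed.

Lemma iint_abs_le E f C : mfin E -> bcont f -> (forall x, E x -> `|f x| <= C) ->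
  `|iint E f| <= C * vol E.
Proof.
move=> mE cf fC; rewrite ler_norml; apply/andP; split.
  rewrite -mulNr -iint_cst//; apply: iint_le => //; first exact: bcont_cst.
  by move=> x /fC; rewrite ler_norml => /andP[].
rewrite -iint_cst//; apply: iint_le => //; first exact: bcont_cst.
by move=> x /fC; rewrite ler_norml => /andP[].
Qed.

Lemma iintU E F f : mfin E -> mfin F -> bcont f -> [disjoint E & F] ->
  iint (E `|` F) f = iint E f + iint F f.
Proof.
move=> mE mF cf EF.
exact: (@Rintegral_setU _ T R (@lebm R d) E F f mE.1 mF.1 (bcont_integrable (mfinU mE mF) cf) EF).
Qed.

Lemma iintDI E F f : mfin E -> lmeas F -> bcont f ->
  iint E f = iint (E `\` F) f + iint (E `&` F) f.
Proof.
move=> mE mF cf; rewrite -iintU//; [|exact: mfinD|exact: mfinI|].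
  by rewrite setUC setUIDK.
by apply/eqP; rewrite -subset0 => x [[_ ?] []].
Qed.

Lemma iint_diff E F f : mfin E -> mfin F -> bcont f ->
  iint E f - iint F f = iint (E `\` F) f - iint (F `\` E) f.
Proof.
move=> mE mF cf; rewrite (iintDI mE mF.1)// (iintDI mF mE.1)// (setIC F E); ring.
Qed.

Lemma iint_diff_le E F f C : mfin E -> mfin F -> bcont f -> (forall x, `|f x| <= C) ->
  `|iint E f - iint F f| <= C * vol (E `+` F).
Proof.
move=> mE mF cf fC; rewrite iint_diff// volY// mulrDr.
apply: le_trans (ler_normB _ _) _.
by apply: lerD; apply: iint_abs_le => //; [exact: mfinD mF.1|exact: mfinD mE.1].
Qed.

(** On the layer-cake form the change of variables is translation invariance of [leb] at each
    level. *)
Lemma iint_shift E f h : mfin E -> bcont f ->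
  iint E (fun x => f (x + h)) = iint (trans (- h) E) f.
Proof.
move=> mE cf; apply: EFin_inj; rewrite -!integ_iint//.
- rewrite /integ; congr (_ - _)%E; apply: eq_integral => t _;
    by rewrite -(leb_trans (- h)); congr leb; apply/funext => x; rewrite /trans/= subrK.
- exact: mfin_trans.
- exact: bcont_shift.
Qed.

Lemma sC1c_bcont f : sC1c f -> bcont f.
Proof.
move=> sf; have cf := sC1c_continuous sf; split => //.
by have [C _ fC] := bdsupp_bounded cf sf.2; exists C.
Qed.

Lemma sC1c_derive_bcont f j : sC1c f -> bcont ('D_(unitv R j) f).
Proof.
move=> sf; split; first exact: (sf.1 j).2.
by have [C _ fC] := sC1c_derive_bounded j sf; exists C.
Qed.

End iint.

(** * Perimeter *)

Section perimeter.
Variables (R : realType) (d : nat).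
Notation V := 'rV[R]_d.+1.
Implicit Types (E F A B : set V) (h v x : V) (f g : V -> R) (phi : V -> V).

Lemma shift_quotient f h x v :
  (fun t : R => t^-1 *: (((fun y => f (y + h)) \o shift x) (t *: v) - f (x + h))) =
  (fun t : R => t^-1 *: ((f \o shift (x + h)) (t *: v) - f (x + h))).
Proof. by apply/funext => t /=; rewrite addrA. Qed.

Lemma derive_shift f h v x : 'D_v (fun x => f (x + h)) x = 'D_v f (x + h).
Proof. by rewrite /derive shift_quotient. Qed.

Lemma derivable_shift f h v x :
  derivable f (x + h) v -> derivable (fun x => f (x + h)) x v.
Proof. by rewrite /derivable shift_quotient. Qed.

Lemma sC1c_shift f h : sC1c f -> sC1c (fun x => f (x + h)).
Proof.
move=> [df [M fM]]; split; last first.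
  exists (M + `|h|) => x Mx; apply: fM.
  have : `|x| <= `|x + h| + `|h| by rewrite -{1}(addrK h x) ler_normB.
  by move: Mx; lra.
move=> j; split; first by move=> x; apply: derivable_shift; exact: (df j).1.
have -> : 'D_(unitv R j) (fun x => f (x + h)) = fun x => 'D_(unitv R j) f (x + h).
  by apply/funext => x; rewrite derive_shift.
move=> x; apply: (@continuous_comp _ _ _ (fun x : V => x + h) ('D_(unitv R j) f));
  last exact: (df j).2.
by apply: continuousD; [exact: cvg_id|exact: cst_continuous].
Qed.

Lemma derive_zero v : 'D_v (fun=> 0 : R) = (fun=> 0) :> (V -> R).
Proof. by apply/funext => x; rewrite derive_cst. Qed.

Lemma sC1c0 : @sC1c R d.+1 (fun=> 0).
Proof.
split=> [j|]; last by exists 0.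
by rewrite derive_zero; split=> [x|]; [exact: derivable_cst|exact: cst_continuous].
Qed.

Definition axis_field f j : V -> V := fun x => f x *: unitv R j.

Lemma compo_axis_field f j i : compo (axis_field f j) i =
  if j == i then f else fun=> 0.
Proof.
apply/funext => x; rewrite /compo/axis_field !mxE eqxx/= eq_sym.
by case: (j == i); rewrite ?mulr1 ?mulr0.
Qed.

Lemma C1c_axis_field f j : sC1c f -> C1c (axis_field f j).
Proof.
move=> [df [M fM]]; split=> [i k|].
  rewrite compo_axis_field; case: eqP => _; first exact: df.
  exact: sC1c0.1.
exists [set x | `|x| <= M]; split; first exact: closed_ball_rv_compact.
by move=> x /negP; rewrite -ltNge => /fM fx; rewrite /axis_field fx scale0r.
Qed.

Lemma unit_bounded_axis_field f j : (forall x, `|f x| <= 1) ->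
  unit_bounded (axis_field f j).
Proof.
move=> f1 x; rewrite (bigD1 j)//= big1 ?addr0.
  by rewrite !mxE !eqxx/= mulr1 -real_normK ?num_real// expr_le1.
by move=> i ij; rewrite !mxE eqxx/= (negbTE ij) mulr0 expr0n.
Qed.

Lemma divg_axis_field f j : divg (axis_field f j) = 'D_(unitv R j) f.
Proof.
apply/funext => x; rewrite /divg (bigD1 j)//= compo_axis_field eqxx big1 ?addr0//.
by move=> i ij; rewrite compo_axis_field eq_sym (negbTE ij) derive_cst.
Qed.

Lemma perim_test E f j : sC1c f -> (forall x, `|f x| <= 1) ->
  (integ E ('D_(unitv R j) f) <= perim E)%E.
Proof.
move=> sf f1; apply: ereal_sup_ubound; exists (axis_field f j).
  by split; [exact: C1c_axis_field|exact: unit_bounded_axis_field].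
by rewrite divg_axis_field.
Qed.

Lemma divg_bcont phi : C1c phi -> bcont (divg phi).
Proof.
by move=> cphi; apply: bcont_sum => i; apply: sC1c_derive_bcont; exact: C1c_compo.
Qed.

Lemma perim_ge0 E : mfin E -> (0 <= perim E)%E.
Proof.
move=> mE; have := @perim_test E _ ord0 sC1c0; rewrite normr0 => /(_ (fun=> ler01)).
have -> : 'D_(unitv R ord0) (fun=> 0 : R) = (fun=> 0) :> (V -> R).
  exact: derive_zero.
by rewrite integ_iint ?iint_cst ?mul0r//; exact: bcont_cst.
Qed.

(** Each functional in the supremum is Lipschitz for the [L^1] distance, the divergence of its field
    being bounded. *)
Lemma perim_lsc E (c : R) : mfin E ->
  (forall e, 0 < e -> exists F, [/\ mfin F, vol (E `+` F) <= e & (perim F <=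
    (c + e)%:E)%E]) ->
  (perim E <= c%:E)%E.
Proof.
move=> mE H; apply: ge_ereal_sup => _ [phi [cphi uphi] <-].
have bd := divg_bcont cphi.
rewrite integ_iint// lee_fin.
have [C C0 HC] : exists2 C, 0 < C & forall x, `|divg phi x| <= C.
  have [_ [C HC]] := bd; exists (`|C| + 1); first by rewrite ltr_wpDl.
  by move=> x; apply: le_trans (HC x) _; rewrite (le_trans (ler_norm _))// lerDl.
apply/ler_addgt0Pr => e e0.
have C10 : 0 < C + 1 by rewrite addr_gt0.
(* The same error bounds the distance, which costs a factor [C], and the perimeter; [e / (C + 1)]
   makes the two sum to [e]. *)
have [F [mF EF PF]] := H _ (divr_gt0 e0 C10).
have PF' : iint F (divg phi) <= c + e / (C + 1).
  rewrite -lee_fin -integ_iint//; apply: le_trans PF.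
  by apply: ereal_sup_ubound; exists phi.
have := iint_diff_le mE mF bd HC; rewrite ler_norml => /andP[_].
have : C * vol (E `+` F) <= C * (e / (C + 1)) by rewrite ler_pM2l.
have : C * (e / (C + 1)) + e / (C + 1) = e by field; rewrite gt_eqF.
by lra.
Qed.

(* The derivative of [s |-> int_(E + s e_j) f] is the integral over [E] of the
   divergence of a translate of [f e_j], hence at most [perim E]. *)
Lemma perim_translate_test E f j (p s : R) : mfin E -> (perim E <= p%:E)%E ->
  sC1c f -> (forall x, `|f x| <= 1) -> 0 < s ->
  iint (trans (- (s *: unitv R j)) E) f - iint E f <= s * p.
Proof.
move=> mE PE sf f1 s0.
have bf := sC1c_bcont sf.
apply/ler_addgt0Pr => e e0.
have v10 : 0 < s * (vol E + 1) by rewrite mulr_gt0// ltr_wpDl ?vol_ge0.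
pose e' := e / (s * (vol E + 1)).
have e'0 : 0 < e' by rewrite divr_gt0.
have [r r0 Hr] := line_expand (sf.1 j).1 (sf.1 j).2 sf.2 e'0.
(* The translation by [s] is made in [m] steps short enough for the expansion. Their errors add up
   to [e' * s * vol E], below [e] by the choice of [e']. *)
have [m m0 mr] : exists2 m : nat, (0 < m)%N & s / m%:R < r.
  exists (Num.bound (s / r)).+1 => //.
  rewrite ltr_pdivrMr// mulrC -ltr_pdivrMr//.
  apply: lt_le_trans (archi_boundP _) _; first by rewrite ltW// divr_gt0.
  by rewrite ler_nat.
pose t := s / m%:R.
have t0 : 0 < t by rewrite divr_gt0// ltr0n.
pose g (k : nat) := fun x : V => f (x + (k%:R * t) *: unitv R j).
have bg k : bcont (g k) by exact: bcont_shift.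
have step k : iint E (g k.+1) - iint E (g k) <= t * p + e' * t * vol E.
  have bD : bcont ('D_(unitv R j) (g k)) by apply: sC1c_derive_bcont; exact: sC1c_shift.
  rewrite -iintB//.
  apply: (@le_trans _ _ (iint E (fun x => t * 'D_(unitv R j) (g k) x + e' * t))).
    apply: iint_le => //; first exact: bcontB.
      by apply: bcontD; [exact: bcontZ|exact: bcont_cst].
    move=> x _; rewrite derive_shift.
    have := Hr (x + (k%:R * t) *: unitv R j) t; rewrite t0 mr => /(_ isT).
    have -> : x + (k%:R * t) *: unitv R j + t *: unitv R j = x + (k.+1%:R * t) *: unitv R j.
      by rewrite -addrA -scalerDl -natr1 mulrDl mul1r.
    by rewrite ler_norml => /andP[_]; rewrite /g; lra.
  rewrite iintD//; [|exact: bcontZ|exact: bcont_cst].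
  rewrite iintZ// iint_cst// lerD2r ler_pM2l// -lee_fin -integ_iint//.
  by apply: le_trans PE; apply: perim_test => [|x]; [exact: sC1c_shift|exact: f1].
have -> : iint (trans (- (s *: unitv R j)) E) f = iint E (g m).
  by rewrite -iint_shift// /g /t [m%:R * _]mulrC divfK// pnatr_eq0 -lt0n.
have -> : iint E f = iint E (g 0).
  by congr iint; apply/funext => x; rewrite /g mul0r scale0r addr0.
have -> : iint E (g m) - iint E (g 0) = \sum_(0 <=
  k < m) (iint E (g k.+1) - iint E (g k)).
  by rewrite telescope_sumr.
apply: (@le_trans _ _ (\sum_(0 <= k < m) (t * p + e' * t * vol E))).
  by apply: ler_sum => k _; exact: step.
rewrite sumr_const_nat subn0 -mulr_natr.
have -> : (t * p + e' * t * vol E) * m%:R = s * p + e * (vol E / (vol E + 1)).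
  rewrite /t /e'; field; rewrite (gt_eqF s0) pnatr_eq0 -lt0n m0/= gt_eqF//.
  by rewrite ltr_wpDl ?vol_ge0.
rewrite lerD2l ler_piMr ?ltW//.
by rewrite ltr_pdivrMr ?mul1r ?ltrDl// ltr_wpDl ?vol_ge0.
Qed.

(** A partial converse of the translation estimate: difference quotients of each component, bounded
    by 1, are tested separately, whence the factor [d.+1]. It serves to show that boxes have finite
    perimeter. *)
Lemma perim_lty_of_translate B (C : R) : mfin B ->
  (forall j (s : R), 0 < s -> vol (trans (- (s *: unitv R j)) B `+` B) <= C * s) ->
  (perim B <= (d.+1%:R * C)%:E)%E.
Proof.
move=> mB H; apply: ge_ereal_sup => _ [phi [cphi uphi] <-].
have sphi i : sC1c (compo phi i) by exact: C1c_compo.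
have bD i : bcont ('D_(unitv R i) (compo phi i)) by exact: sC1c_derive_bcont.
rewrite (integ_iint mB (divg_bcont cphi)) lee_fin iint_sum//.
rewrite mulr_natl -[X in _ *+ X]card_ord -sumr_const; apply: ler_sum => i _.
set f := compo phi i.
have bf : bcont f by exact: (sC1c_bcont (sphi i)).
have bDf : bcont ('D_(unitv R i) f) by exact: bD.
have f1 x : `|f x| <= 1.
  have := uphi x; rewrite (bigD1 i)//= -/(f x) => u.
  rewrite -[leRHS]normr1 -ler_sqr ?nnegrE// !real_normK ?num_real// expr1n.
  by apply: le_trans u; rewrite lerDl sumr_ge0// => k _; exact: sqr_ge0.
apply/ler_addgt0Pr => e e0.
have v10 : 0 < vol B + 1 by rewrite ltr_wpDl ?vol_ge0.
pose e' := e / (vol B + 1).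
have e'0 : 0 < e' by rewrite divr_gt0.
have [r r0 Hr] := line_expand ((sphi i).1 i).1 ((sphi i).1 i).2 (sphi i).2 e'0.
pose s := r / 2.
have s0 : 0 < s by rewrite divr_gt0.
have sr : s < r by rewrite gtr_pMr// invf_lt1// ltr1n.
pose h := s *: unitv R i.
have bfh : bcont (fun x => f (x + h)) by exact: bcont_shift.
have : s * iint B ('D_(unitv R i) f) <=
  iint (trans (- h) B) f - iint B f + e' * s * vol B.
  rewrite -iintZ// -iint_shift// -iintB// -iint_cst// -iintD//;
    [|exact: bcontB|exact: bcont_cst].
  apply: iint_le => //; first exact: bcontZ.
    by apply: bcontD; [exact: bcontB|exact: bcont_cst].
  move=> x _; have := Hr x s; rewrite s0 sr => /(_ isT).
  by rewrite ler_norml => /andP[]; rewrite -/f -/h; lra.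
have := iint_diff_le (mfin_trans (- h) mB) mB bf f1;
  rewrite ler_norml mul1r => /andP[_].
have := H i s s0; rewrite -/h => u1 u2 u3.
have e'e : e' * vol B <= e.
  by rewrite /e' mulrAC ler_pdivrMr// ler_pM2l// lerDl.
rewrite -(ler_pM2l s0) mulrDr (mulrC s C).
have : e' * s * vol B <= s * e by rewrite mulrAC mulrC ler_pM2l.
by lra.
Qed.

Lemma perim_box_lty (a b : V) : (perim (box a b) < +oo)%E.
Proof.
pose S j := \prod_(i < d.+1 | i != j) Num.max 0 (b 0 i - a 0 i).
have S0 j : 0 <= S j by apply: prodr_ge0 => i _; rewrite le_max lexx.
(* A shift by [s] along axis [j] moves two slabs of volume [s * S j]; the sum over [j] bounds all
   directions at once. *)
pose C := \sum_j 2 * S j.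
apply: le_lt_trans (_ : (perim (box a b) <= (d.+1%:R * C)%:E)%E) (ltry _).
apply: perim_lty_of_translate; first exact: mfin_box.
move=> j s s0.
have sub : trans (- (s *: unitv R j)) (box a b) `+` box a b `<=`
    box a (upd b j (a 0 j + s)) `|` box (upd a j (b 0 j)) (upd b j (b 0 j + s)).
  have shE x i : (x - s *: unitv R j : V) 0 i = x 0 i - (if i == j then s else 0).
    by rewrite !mxE eqxx/=; case: eqP => _; rewrite ?mulr1 ?mulr0.
  move=> x [[/= tx /existsNP[i xi]]|[xab /existsNP[i /= xi]]].
    right; have xj k : k != j -> a 0 k <= x 0 k <= b 0 k.
      by move=> /negbTE kj; have := tx k; rewrite shE kj subr0.
    have ij : i = j by apply: contra_notP xi => /eqP; exact: xj.
    subst i; move: xi => /negP; rewrite negb_and -!ltNge => xi k; rewrite !updE.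
    case: eqVneq => [->|kj]; last exact: xj.
    have := tx j; rewrite shE eqxx => /andP[u1 u2].
    by case/orP: xi => ?; apply/andP; split; lra.
  left => k; rewrite !updE.
  have xj : i = j.
    by apply: contra_notP xi => /eqP/negbTE ij; rewrite shE ij subr0; exact: xab.
  subst i; move: xi => /negP; rewrite negb_and -!ltNge shE eqxx => xi.
  case: eqVneq => [->|kj]; last exact: xab.
  have /andP[u1 u2] := xab j.
  by case/orP: xi => ?; apply/andP; split; lra.
apply: le_trans (vol_le _ sub) _; first by apply: mfinU; exact: mfin_box.
apply: le_trans (volU_le (mfin_box _ _) (mfin_box _ _)) _.
have upd_prod (a' b' : V) : (forall i, i != j -> a' 0 i = a 0 i) -> (forall i, i != j -> b' 0 i = b 0 i) ->
    \prod_(i < d.+1 | i != j) Num.max 0 (b' 0 i - a' 0 i) = S j.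
  by move=> aa bb; apply: eq_bigr => i ij; rewrite aa// bb.
rewrite /vol !leb_box/= !boxvol_updr upd_prod// upd_prod//; last first.
  by move=> i ij; rewrite updE (negbTE ij).
rewrite updE eqxx !(addrC _ s) !addrK (max_r (ltW s0)) -mulr2n -mulr_natl mulrA mulrAC.
rewrite ler_pM2r// /C (bigD1 j)//= lerDl sumr_ge0// => i _.
by rewrite mulr_ge0.
Qed.

End perimeter.

(** * Density of C^1 functions and translations *)

Section bump.
Variables (R : realType) (d : nat).
Notation V := 'rV[R]_d.
Implicit Types (a b x v : V) (f g : V -> R).

(** The square smooths the kink at 0 just enough to be C^1, the regularity asked of test fields. *)
Definition sqpos (t : R) : R := Num.max 0 t ^+ 2.

Lemma sqpos_ge0 t : 0 <= sqpos t. Proof. exact: sqr_ge0. Qed.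

Lemma sqpos_le0 t : t <= 0 -> sqpos t = 0.
Proof. by move=> t0; rewrite /sqpos max_l// expr0n. Qed.

Lemma sqpos_taylor (t h : R) :
  `|sqpos (t + h) - sqpos t - h * (2 * Num.max 0 t)| <= h ^+ 2.
Proof.
rewrite /sqpos ler_norml; have [t0|t0] := leP 0 t; have [th0|th0] := leP 0 (t + h);
  by apply/andP; split; nra.
Qed.

(** Differentiates [sqpos] along a coordinate direction from its Taylor bound, with no case
    distinction at the kink. *)
Lemma quad_is_derive f x v (L : R) :
  (forall h : R, `|f (x + h *: v) - f x - h * L| <= h ^+ 2) ->
  is_derive x v f L.
Proof.
move=> H.
have cv : (fun h : R => h^-1 *: ((f \o shift x) (h *: v) - f x)) @ 0^' --> L.
  apply/cvgrPdist_lt => e e0; near=> h.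
  have h0 : h != 0 by near: h; exact: nbhs_dnbhs_neq.
  rewrite distrC [_ *: _]mulrC.
  rewrite (_ : _ / h - L = (f (x + h *: v) - f x - h * L) / h); last first.
    by rewrite /= (addrC _ x); field.
  rewrite normrM normfV ltr_pdivrMr ?normr_gt0//.
  apply: le_lt_trans (H h) _.
  rewrite -real_normK ?num_real// expr2 ltr_pM2r ?normr_gt0//.
  near: h; apply: dnbhs0_lt => //.
by split; [apply/cvg_ex; exists L|exact: cvg_lim cv].
Unshelve. all: by end_near. Qed.

(* Unlike [sC1c], no support condition: this class is closed under inverses. *)
Definition sC1 f := continuous f /\ forall j, (forall x, derivable f x (unitv R j)) /\
  continuous ('D_(unitv R j) f).

Lemma sC1_sC1c f : sC1 f -> bdsupp f -> sC1c f.
Proof. by move=> [_ df] bf. Qed.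

Lemma sC1_cst c : sC1 (fun=> c).
Proof.
split; first exact: cst_continuous.
move=> j; split; first by move=> x; exact: derivable_cst.
rewrite (_ : 'D_ _ _ = fun=> 0); first exact: cst_continuous.
by apply/funext => x; rewrite derive_cst.
Qed.

Lemma sC1D f g : sC1 f -> sC1 g -> sC1 (f + g).
Proof.
move=> [cf df] [cg dg]; split; first by move=> x; apply: continuousD;
  [exact: cf|exact: cg].
move=> j; split; first by move=> x; apply: derivableD;
  [exact: (df j).1|exact: (dg j).1].
rewrite (_ : 'D_ _ _ = 'D_(unitv R j) f + 'D_(unitv R j) g).
  by move=> x; apply: continuousD; [exact: (df j).2|exact: (dg j).2].
by apply/funext => x; rewrite deriveD//; [exact: (df j).1|exact: (dg j).1].
Qed.

Lemma sC1M f g : sC1 f -> sC1 g -> sC1 (f * g).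
Proof.
move=> [cf df] [cg dg]; split; first by move=> x; apply: continuousM;
  [exact: cf|exact: cg].
move=> j; split; first by move=> x; apply: derivableM;
  [exact: (df j).1|exact: (dg j).1].
rewrite (_ : 'D_ _ _ = (f : V -> R) * 'D_(unitv R j) g + (g : V -> R) * 'D_(unitv R j) f).
  move=> x; apply: continuousD.
    by apply: continuousM; [exact: cf|exact: (dg j).2].
  by apply: continuousM; [exact: cg|exact: (df j).2].
by apply/funext => x; rewrite deriveM//; [exact: (df j).1|exact: (dg j).1].
Qed.

Lemma sC1V f : (forall x, f x != 0) -> sC1 f -> sC1 (fun x => (f x)^-1).
Proof.
move=> f0 [cf df]; split; first by move=> x; apply: continuousV; [exact: f0|exact: cf].
move=> j; split; first by move=> x; apply: derivableV; [exact: f0|exact: (df j).1].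
have cV : continuous (fun x => (f x)^-1).
  by move=> x; apply: continuousV; [exact: f0|exact: cf].
rewrite (_ : 'D_ _ _ = fun x => -1 * ((f x)^-1 * (f x)^-1) * 'D_(unitv R j) f x).
  move=> x; apply: (@continuousM R _ (fun y : V => -1 * ((f y)^-1 * (f y)^-1)) ('D_(unitv R j) f : V -> R)); last exact: (df j).2.
  apply: (@continuousM R _ (fun=> -1) (fun y : V => (f y)^-1 * (f y)^-1));
    first exact: cst_continuous.
  by apply: continuousM; exact: cV.
apply/funext => x; rewrite deriveV//; last exact: (df j).1.
by rewrite [_ *: _]mulrC mulrC -exprVn expr2 mulN1r.
Qed.

Lemma sC1_sum (I : Type) (s : seq I) (F : I -> V -> R) : (forall i, sC1 (F i)) ->
  sC1 (fun x => \sum_(i <- s) F i x).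
Proof.
move=> cF; rewrite (_ : (fun x => _) = \sum_(i <- s) F i); last first.
  by apply/funext => x; rewrite fct_sumE.
elim/big_ind : _ => //; first exact: (sC1_cst 0).
by move=> u v; exact: sC1D.
Qed.

Lemma sC1_prod (I : Type) (s : seq I) (F : I -> V -> R) : (forall i, sC1 (F i)) ->
  sC1 (fun x => \prod_(i <- s) F i x).
Proof.
move=> cF; rewrite (_ : (fun x => _) = \prod_(i <- s) F i); last first.
  by apply/funext => x; elim/big_rec2 : _ => // i y1 y2 _ ->.
elim/big_ind : _ => //; first exact: (sC1_cst 1).
by move=> u v; exact: sC1M.
Qed.

(** The sign [sg] is 1 for a lower face of a box and -1 for an upper one. *)
Lemma sC1_sqpos_coord (c sg : R) i : sg ^+ 2 = 1 -> sC1 (fun x => sqpos (c + sg * x 0 i)).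
Proof.
move=> sg1.
have D j x : is_derive x (unitv R j) (fun x : V => sqpos (c + sg * x 0 i))
    ((i == j)%:R * sg * (2 * Num.max 0 (c + sg * x 0 i))).
  apply: quad_is_derive => h.
  rewrite !mxE eqxx/= mulrDr addrA.
  have := sqpos_taylor (c + sg * x 0 i) (sg * (h * (i == j)%:R)).
  case: (i == j) => /=; last first.
    by rewrite ?mulr0n !(mulr0, mul0r, addr0) subrr subr0 normr0 => _; exact: sqr_ge0.
  rewrite !mulr1 mul1r exprMn sg1 mul1r.
  by rewrite (_ : h * (sg * _) = sg * h * (2 * Num.max 0 (c + sg * x 0 i)))//; ring.
have ccoord : continuous (fun x : V => c + sg * x 0 i).
  move=> x; apply: (@continuousD R R^o V (fun=> c) (fun y : V => sg * y 0 i));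
    first exact: cst_continuous.
  apply: (@continuousM R V (fun=> sg) (fun y : V => y 0 i));
    first exact: cst_continuous.
  exact: coord_continuous.
have cmax : continuous (fun x : V => Num.max 0 (c + sg * x 0 i)).
  move=> x; apply: (@continuous_max R V (fun=> 0) (fun x : V => c + sg * x 0 i)).
    exact: cst_continuous.
  exact: ccoord.
split; first by move=> x; apply: (@continuousM R V); exact: cmax.
move=> j; split; first by move=> x; have [] := D j x.
rewrite (_ : 'D_ _ _ = fun x => (i == j)%:R * sg * (2 * Num.max 0 (c + sg * x 0 i))).
  move=> x; apply: (@continuousM R V (fun=> (i == j)%:R * sg) (fun y : V => 2 * Num.max 0 (c + sg * y 0 i))).
    exact: cst_continuous.
  by apply: (@continuousM R V (fun=> 2)); [exact: cst_continuous|exact: cmax].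
by apply/funext => x; have [] := D j x.
Qed.

Definition box_bump a b x :=
  \prod_i (sqpos (- a 0 i + 1 * x 0 i) * sqpos (b 0 i + (-1) * x 0 i)).

Lemma bump_sC1 a b : sC1 (box_bump a b).
Proof.
apply: sC1_prod => i; apply: sC1M; apply: sC1_sqpos_coord.
  by rewrite expr1n.
by rewrite sqrrN expr1n.
Qed.

Lemma bump_ge0 a b x : 0 <= box_bump a b x.
Proof. by apply: prodr_ge0 => i _; rewrite mulr_ge0 ?sqpos_ge0. Qed.

Lemma bump_eq0 a b x : ~ box a b x -> box_bump a b x = 0.
Proof.
move=> /existsNP[i xi]; rewrite /box_bump (bigD1 i)//=.
suff -> : sqpos (- a 0 i + 1 * x 0 i) * sqpos (b 0 i + (-1) * x 0 i) = 0 by rewrite mul0r.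
move/negP : xi; rewrite negb_and -!ltNge => /orP[xi|xi].
  by rewrite sqpos_le0 ?mul0r// mul1r; lra.
by rewrite mulrC sqpos_le0 ?mul0r// mulN1r; lra.
Qed.

Lemma bump_ge a b x (e : R) : 0 < e -> (forall i, a 0 i + e <= x 0 i <= b 0 i - e) ->
  (e ^+ 4) ^+ d <= box_bump a b x.
Proof.
move=> e0 H; rewrite -[X in _ ^+ X]card_ord -prodr_const /box_bump.
apply: ler_prod => i _; rewrite (exprn_ge0 _ (ltW e0))/=.
have sq t : e <= t -> e ^+ 2 <= sqpos t.
  move=> et; rewrite /sqpos max_r; last by lra.
  by rewrite ler_pXn2r// nnegrE; lra.
have /andP[u1 u2] := H i.
rewrite (_ : e ^+ 4 = e ^+ 2 * e ^+ 2); last by rewrite -exprD.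
by apply: ler_pM; rewrite ?sqr_ge0//; apply: sq; [rewrite mul1r|rewrite mulN1r]; lra.
Qed.

Lemma bdsupp_box a b f : (forall x, ~ box a b x -> f x = 0) -> bdsupp f.
Proof.
move=> H; exists (`|a| + `|b|) => x Mx; apply: H => xab.
move: Mx; rewrite ltNge => /negP; apply; apply: rv_norm_le => [|i];
  first by rewrite addr_ge0.
have /andP[u1 u2] := xab i.
have := coord_le_norm a i; have := coord_le_norm b i.
rewrite !ler_norml => /andP[v1 v2] /andP[w1 w2]; apply/andP.
have := normr_ge0 a; have := normr_ge0 b.
by split; lra.
Qed.

Lemma bdsupp_sum (I : Type) (s : seq I) (F : I -> V -> R) : (forall i, bdsupp (F i)) ->
  bdsupp (fun x => \sum_(i <- s) F i x).
Proof.
move=> bF; elim: s => [|i s [M HM]]; first by exists 0 => x _; rewrite big_nil.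
have [N HN] := bF i; exists (Num.max M N) => x; rewrite gt_max => /andP[u v].
by rewrite big_cons HN// HM// addr0.
Qed.

End bump.

(** * Approximation of indicators and the translation estimate *)

Section density.
Variables (R : realType) (d : nat).
Notation V := 'rV[R]_d.+1.
Notation T := (caratheodory_type (@leb R d.+1)).
Implicit Types (E F A B : set V) (h : V) (f g : V -> R).

Lemma boxvol_enlarge (a b : V) e : 0 < e -> exists2 t : R, 0 < t &
  boxvol (a - const_mx t) (b + const_mx t) <= boxvol a b + e.
Proof.
move=> e0.
pose F (t : R) := \prod_(i < d.+1) Num.max 0 ((b 0 i + t) - (a 0 i - t)).
have FE t : boxvol (a - const_mx t) (b + const_mx t) = F t.
  by apply: eq_bigr => i _; rewrite !mxE.
have F0 : boxvol a b = F 0 by apply: eq_bigr => i _; rewrite addr0 subr0.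
have cF : continuous F.
  apply: (@continuous_big R^o _ *%R 1); first exact: mul_continuous.
  move=> i _ t; apply: (@continuous_max R R^o (fun=> 0) (fun t => (b 0 i + t) - (a 0 i - t))).
    exact: cst_continuous.
  apply: (@continuousB R R^o R^o (fun t => b 0 i + t) (fun t => a 0 i - t)).
    by apply: (@continuousD R R^o R^o (fun=> b 0 i) id);
      [exact: cst_continuous|exact: cvg_id].
  by apply: (@continuousB R R^o R^o (fun=> a 0 i) id);
    [exact: cst_continuous|exact: cvg_id].
have /cvgrPdist_lt/(_ _ e0)/nbhs_ballP[r /= r0 H] := cF 0.
have r20 : 0 < r / 2 by rewrite divr_gt0.
exists (r / 2) => //; rewrite FE F0.
have : ball (0 : R) r (r / 2).
  by rewrite -ball_normE/= sub0r normrN gtr0_norm// gtr_pMr// invf_lt1// ltr1n.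
move=> /H/=; rewrite distrC ltr_norml => /andP[_]; lra.
Qed.

(** The boxes of a near-optimal cover are enlarged, and a finite sum [w] of bumps on them is
    saturated into [f = 1 - 1 / (1 + n w)]: zero off the enlarged cover, near 1 where [w] is bounded
    below. The error outside [E] is stated against each [B] of finite measure because the complement
    of [E] has infinite measure. *)
Lemma density E (e : R) : mfin E -> 0 < e -> exists f, [/\ sC1c f,
  (forall x, 0 <= f x <= 1), iint E (fun x => 1 - f x) <= e &
  forall B, mfin B -> [disjoint E & B] -> iint B f <= e].
Proof.
move=> mE e0; pose e1 := e / 2.
have e10 : 0 < e1 by rewrite divr_gt0.
have Ee1 : (leb E < leb E + e1%:E)%E by rewrite lebE// lte_fin ltrDl.
have [a [b [EU sab]]] := leb_cover_lt Ee1.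
have /choice[t Ht] : forall k, exists t : R, 0 < t /\
    boxvol (a k - const_mx t) (b k + const_mx t) <=
      boxvol (a k) (b k) + e1 / (2 ^ k.+1)%:R.
  by move=> k; have [|t] := @boxvol_enlarge (a k) (b k) (e1 / (2 ^ k.+1)%:R);
    [rewrite divr_gt0// ltr0n expn_gt0|exists t].
pose a' k := a k - const_mx (t k); pose b' k := b k + const_mx (t k).
pose U := \bigcup_k box (a' k) (b' k).
have mU : lmeas U by apply: (@bigcupT_measurable _ T) => k; exact: lmeas_box.
have EsubU : E `<=` U.
  move=> x /EU[k _ xk]; exists k => // i; have := xk i; have [tk _] := Ht k.
  by rewrite !mxE => /andP[u v]; apply/andP; split; lra.
have lebU : (leb U <= leb E + (e1 + e1)%:E)%E.
  apply: (@le_trans _ _ (\sum_(0 <= k <oo) (boxvol (a' k) (b' k))%:E)%E);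
    first exact: leb_cover.
  apply: (@le_trans _ _ (\sum_(0 <=
    k <oo) ((boxvol (a k) (b k))%:E + (e1 / (2 ^ k.+1)%:R)%:E))%E).
    apply: lee_nneseries => k _; first by rewrite lee_fin boxvol_ge0.
    by rewrite -EFinD lee_fin; exact: (Ht k).2.
  apply: le_trans (epsilon_trick _ _ (ltW e10)) _; first by move=> k;
    rewrite lee_fin boxvol_ge0.
  by rewrite EFinD addeA leeD2r// ltW.
have fU : mfin U by split => //; apply: le_lt_trans lebU _; rewrite lebE// ltry.
have volUE : vol (U `\` E) <= e.
  have := volDI fU mE.1; rewrite (_ : U `&` E = E); last by rewrite setIidr.
  have : vol U <= vol E + (e1 + e1) by rewrite -lee_fin -lebE// EFinD -lebE.
  by rewrite /e1; lra.
(* Finitely many boxes already cover [E] up to measure [e1], so finitely many bumps suffice and the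
   support stays bounded. *)
have [K HK] : exists K, (\sum_(K <= k <oo) (boxvol (a k) (b k))%:E <= e1%:E)%E.
  have /nneseries_tail_cvg : (\sum_(0 <= k <oo) (boxvol (a k) (b k))%:E < +oo)%E.
    by apply: lt_le_trans sab _; rewrite leey.
  move=> /(_ (fun k _ => boxvol_ge0 (a k) (b k))) cv.
  have : \forall N \near \oo, (\sum_(N <= k <oo) (boxvol (a k) (b k))%:E < e1%:E)%E.
    apply: (cv [set y | (y < e1%:E)%E]); apply: open_nbhs_nbhs.
    by split; [exact: open_ereal_lt_ereal|rewrite /= lte_fin].
  by move=> [N _ /(_ N (leqnn N))] H; exists N; exact: ltW.
pose UK := \bigcup_(k in `I_K) box (a k) (b k).
have mUK : lmeas UK by apply: (@bigcup_measurable _ T) => k _; exact: lmeas_box.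
have volEUK : vol (E `\` UK) <= e1.
  rewrite -lee_fin -lebE; last exact: mfinD.
  apply: le_trans HK;
    apply: (@le_trans _ _ (leb (\bigcup_(n in ~` `I_K) box (a n) (b n)))).
    apply: le_leb => x [/EU[k _ xk] nx]; exists k => //= kK.
    by apply: nx; exists k.
  apply: le_trans (outer_measure_sigma_subadditive_tail _ _ _) _.
  by apply: lee_nneseries => k _; rewrite /= ?leb_ge0// leb_box.
pose w x := \sum_(k <- iota 0 K) box_bump (a' k) (b' k) x.
(* Lower bound of the bump [k] on the original box, which stays at distance [t k] from the faces of
   the enlarged one. *)
pose c k := (t k ^+ 4) ^+ d.+1.
have c0 k : 0 < c k by rewrite !exprn_gt0// (Ht k).1.
pose dl := e1 / (vol E + 1).
have v10 : 0 < vol E + 1 by rewrite ltr_wpDl ?vol_ge0.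
have dl0 : 0 < dl by rewrite divr_gt0.
(* Large enough that [n * c k >= 1 / dl] for every [k < K]; the sum stands in for a maximum. *)
pose n := \sum_(k <- iota 0 K) (c k * dl)^-1.
have n0 : 0 <= n by apply: sumr_ge0 => k _; rewrite invr_ge0 mulr_ge0// ltW.
have w0 x : 0 <= w x by apply: sumr_ge0 => k _; exact: bump_ge0.
have nw1 x : 1 <= 1 + n * w x by rewrite lerDl mulr_ge0.
have nw0 x : 0 < 1 + n * w x by apply: lt_le_trans (nw1 x).
have wUK x : UK x -> (1 + n * w x)^-1 <= dl.
  move=> [k /= kK xk].
  have ki : k \in iota 0 K by rewrite mem_iota.
  have wc : c k <= w x.
    apply: le_trans (_ : box_bump (a' k) (b' k) x <= _).
      apply: bump_ge; first exact: (Ht k).1.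
      move=> i; rewrite !mxE; have /andP[u v] := xk i.
      by apply/andP; split; lra.
    by rewrite /w (bigD1_seq k)//= ?iota_uniq// lerDl sumr_ge0// => ? _;
      exact: bump_ge0.
  have nc : (c k * dl)^-1 <= n.
    rewrite /n (bigD1_seq k)//= ?iota_uniq// lerDl sumr_ge0// => ? _.
    by rewrite invr_ge0 mulr_ge0// ltW.
  rewrite -[leRHS]invrK lef_pV2 ?posrE ?invr_gt0//.
  apply: (@le_trans _ _ ((c k * dl)^-1 * c k)).
    by rewrite (invfM (c k) dl) mulrAC mulVf ?mul1r// gt_eqF.
  apply: (@le_trans _ _ (n * w x)); last by rewrite lerDr.
  apply: ler_pM => //; last exact: ltW.
  by rewrite invr_ge0 mulr_ge0// ltW.
pose f x := 1 - (1 + n * w x)^-1.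
have sw : sC1 w by apply: sC1_sum => k; exact: bump_sC1.
have siv : sC1 (fun x => (1 + n * w x)^-1).
  apply: sC1V; first by move=> x; rewrite gt_eqF.
  rewrite (_ : (fun x => 1 + n * w x) = (fun=> 1) + (fun=> n) * w)//.
  apply: sC1D; first exact: sC1_cst.
  by apply: sC1M => //; exact: sC1_cst.
have fE x : 1 - f x = (1 + n * w x)^-1 by rewrite /f subKr.
have wU x : ~ U x -> w x = 0.
  move=> nU; rewrite /w big1// => k _; apply: bump_eq0 => xk; apply: nU.
  by exists k.
have f0 x : w x = 0 -> f x = 0 by move=> wx; rewrite /f wx mulr0 addr0 invr1 subrr.
have sf : sC1c f.
  apply: sC1_sC1c.
    rewrite (_ : f = (fun=> 1) + (fun=> -1) * (fun x => (1 + n * w x)^-1)).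
      apply: sC1D; first exact: sC1_cst.
      by apply: sC1M => //; exact: sC1_cst.
    by apply/funext => x; rewrite [RHS](_ : _ = 1 + (-1) * (1 + n * w x)^-1)// mulN1r.
  have [M HM] : bdsupp w.
    apply: bdsupp_sum => k; apply: bdsupp_box => x; exact: bump_eq0.
  by exists M => x Mx; apply: f0; exact: HM.
have f01 x : 0 <= f x <= 1.
  by rewrite /f subr_ge0 invf_le1// nw1/= gerBl invr_ge0 ltW.
have bf := sC1c_bcont sf.
have b1f : bcont (fun x => 1 - f x) by apply: bcontB => //; exact: bcont_cst.
exists f; split => //.
  rewrite (iintDI mE mUK b1f) (_ : e = e1 + e1); last by rewrite /e1 -splitr.
  apply: lerD.
    apply: le_trans volEUK; rewrite -[leRHS]mul1r -iint_cst; last exact: mfinD.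
    apply: iint_le => //; [exact: mfinD|exact: bcont_cst|].
    by move=> x _; rewrite gerBl; case/andP: (f01 x).
  apply: (@le_trans _ _ (dl * vol (E `&` UK))).
    rewrite -iint_cst; last exact: mfinI.
    apply: iint_le => //; [exact: mfinI|exact: bcont_cst|].
    by move=> x [_ /wUK]; rewrite fE.
  rewrite /dl mulrAC ler_pdivrMr// ler_pM2l//.
  by apply: le_trans (vol_le mE (@subIsetl _ _ _)) _; rewrite lerDl.
move=> B mB EB; apply: le_trans volUE.
rewrite (iintDI mB mU bf).
have -> : iint (B `\` U) f = 0.
  apply/eqP; rewrite eq_le; apply/andP; split.
    rewrite -(mul0r (vol (B `\` U))) -iint_cst; last exact: mfinD.
    apply: iint_le => //; [exact: mfinD|exact: bcont_cst|].
    by move=> x [_ /wU/f0 ->].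
  by apply: iint_ge0 => //; [exact: mfinD|move=> x _; case/andP: (f01 x)].
rewrite add0r; apply: (@le_trans _ _ (vol (B `&` U))).
  rewrite -[leRHS]mul1r -iint_cst; last exact: mfinI.
  apply: iint_le => //; [exact: mfinI|exact: bcont_cst|].
  by move=> x _; case/andP: (f01 x).
apply: vol_le; first exact: mfinD mE.1.
move=> x [Bx Ux]; split => // Ex; move/eqP: EB; rewrite -subset0; apply.
by split; [exact: Ex|exact: Bx].
Qed.

(** The ideal test function is 1 on [E' \ E] and -1 on [E \ E']. A difference of two approximate
    indicators with values in [[0, 1]] is admissible, and its four integrals cost [e / 4] each. *)
Lemma perim_translate E j (p s : R) : mfin E -> (perim E <= p%:E)%E -> 0 < s ->
  vol (trans (- (s *: unitv R j)) E `+` E) <= s * p.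
Proof.
move=> mE PE s0; set E' := trans _ E.
have mE' : mfin E' by exact: mfin_trans.
rewrite volY//; set A := E' `\` E; set B := E `\` E'.
have mA : mfin A by exact: mfinD mE.1.
have mB : mfin B by exact: mfinD mE'.1.
have AB : [disjoint A & B] by apply/eqP; rewrite -subset0 => x [[? ?] [? ?]].
have BA : [disjoint B & A] by rewrite disj_set_sym.
apply/ler_addgt0Pr => e e0.
have e40 : 0 < e / 4 by rewrite divr_gt0.
have [f [sf f01 fA fB]] := density mA e40.
have [g [sg g01 gB gA]] := density mB e40.
have bf := sC1c_bcont sf; have bg := sC1c_bcont sg.
pose u x := f x - g x.
have su : sC1c u.
  apply: sC1_sC1c.
    have -> : u = f + (fun=> -1) * g.
      by apply/funext => x; rewrite [RHS](_ : _ = f x + (-1) * g x)// mulN1r.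
    have c1 k : sC1c k -> sC1 k by move=> sk; split;
      [exact: sC1c_continuous|exact: sk.1].
    apply: sC1D; first exact: c1.
    by apply: sC1M; [exact: sC1_cst|exact: c1].
  have [M HM] := sf.2; have [N HN] := sg.2.
  exists (Num.max M N) => x; rewrite gt_max => /andP[Mx Nx].
  by rewrite /u HM// HN// subr0.
have u1 x : `|u x| <= 1.
  have /andP[? ?] := f01 x; have /andP[? ?] := g01 x.
  by rewrite /u ler_norml; apply/andP; split; lra.
have := perim_translate_test j mE PE su u1 s0.
rewrite -/E' iint_diff//; last exact: bcontB.
rewrite -/A -/B !iintB//.
have b1 := @bcont_cst R d 1.
have := fA; have := gB; rewrite !iintB// !iint_cst// !mul1r.
by have := fB _ mB AB; have := gA _ mA BA; lra.
Qed.

End density.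

(** * Poincare inequality on dyadic cells *)

Section cells.
Variables (R : realType) (d : nat).
Notation V := 'rV[R]_d.+1.
Notation T := (caratheodory_type (@leb R d.+1)).
Implicit Types (E G : set V) (a s h x : V) (f g : V -> R) (l : seq V) (j : 'I_d.+1).

(** Half-open, so that halving gives an exact partition; [s] is a vector because the sides are
    halved one at a time. *)
Definition cell s a : set V := [set x | forall i, a 0 i <= x 0 i < a 0 i + s 0 i].

Lemma cell_trans s a h : trans (- h) (cell s a) = cell s (a + h).
Proof.
by apply/seteqP; split => x H i; have := H i; rewrite !mxE => /andP[u v]; apply/andP;
  split; lra.
Qed.

Lemma lmeas_cell s a : lmeas (cell s a).
Proof.
have -> : cell s a = \bigcap_(i in [set: 'I_d.+1])
    ((fun x : T => (x : V) 0 i) @^-1` `[a 0 i, a 0 i + s 0 i[).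
  apply/seteqP; split => [x H i _|x H i].
    by rewrite /= in_itv/=; exact: H.
  by have := H i Logic.I; rewrite /= in_itv.
rewrite lmeasE; apply: fin_bigcap_measurable => // i _.
rewrite -[X in measurable X]setTI; exact: measurable_coord.
Qed.

Lemma mfin_cell s a : mfin (cell s a).
Proof.
apply: mfin_sub (mfin_box a (a + s)) (lmeas_cell s a) _ => x H i.
by have := H i; rewrite !mxE => /andP[u v]; apply/andP; split => //; exact: ltW.
Qed.

Definition cvol s : R := vol (cell s 0).

Lemma vol_cell s a : vol (cell s a) = cvol s.
Proof. by rewrite /cvol -[RHS](vol_trans (- a)) cell_trans add0r. Qed.

Lemma cvol_gt0 s : (forall i, 0 < s 0 i) -> 0 < cvol s.
Proof.
move=> s0; have sub : box 0 (2^-1 *: s) `<=` cell s 0.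
  move=> x H i; have := H i; have := s0 i; rewrite !mxE => ? /andP[u v].
  by apply/andP; split; lra.
apply: lt_le_trans (vol_le (mfin_cell _ _) sub).
rewrite /vol leb_box/=; apply: prodr_gt0 => i _; rewrite !mxE subr0 lt_max.
by rewrite mulr_gt0 ?orbT// invr_gt0.
Qed.

Definition half s j : V := upd s j (s 0 j / 2).
Definition halfstep s j : V := (s 0 j / 2) *: unitv R j.

Lemma halfstepE s j i : halfstep s j 0 i = if i == j then s 0 j / 2 else 0.
Proof. by rewrite !mxE eqxx/=; case: eqP => _; rewrite ?mulr1 ?mulr0. Qed.

Lemma cell_split s a j : 0 < s 0 j ->
  cell s a = cell (half s j) a `|` cell (half s j) (a + halfstep s j).
Proof.
move=> sj; apply/seteqP; split => x.
  move=> H; have [xj|xj] := ltP (x 0 j) (a 0 j + s 0 j / 2); [left|right] => i;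
    have := H i; rewrite [in X in _ -> X]mxE ?updE ?halfstepE;
      case: eqVneq => [->|ij] /andP[u v];
    rewrite ?[(_ + _ : V) _ _]mxE ?halfstepE ?eqxx ?(negbTE ij) ?addr0; apply/andP;
      split; lra.
by move=> [] H i; have := H i; rewrite ?updE ?[(_ + _ : V) _ _]mxE ?halfstepE;
  case: eqVneq => [->|ij] /andP[u v]; apply/andP; split; lra.
Qed.

Lemma cell_split_disj s a j :
  [disjoint cell (half s j) a & cell (half s j) (a + halfstep s j)].
Proof.
apply/eqP; rewrite -subset0 => x [/(_ j) + /(_ j)].
rewrite !updE [(_ + _ : V) _ _]mxE !halfstepE eqxx => /andP[u v] /andP[u' v'].
by move: u' v; lra.
Qed.

Lemma cvol_half s j : 0 < s 0 j -> cvol s = 2 * cvol (half s j).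
Proof.
move=> sj; rewrite {1}/cvol (cell_split 0 sj) volU ?cell_split_disj//;
  [|exact: mfin_cell..].
by rewrite !vol_cell; ring.
Qed.

Definition splits s j l := flatten [seq [:: a; a + halfstep s j] | a <- l].

Lemma sum_splits s j l (F : V -> R) :
  \sum_(a <- splits s j l) F a = \sum_(a <- l) (F a + F (a + halfstep s j)).
Proof.
elim: l => [|a l IH]; first by rewrite !big_nil.
by rewrite /= !big_cons IH addrA.
Qed.

Lemma mem_splits s j l b : b \in splits s j l ->
  exists2 a, a \in l & b = a \/ b = a + halfstep s j.
Proof.
move=> /flattenP[_ /mapP[a al ->]]; rewrite !inE => /orP[] /eqP ->; exists a => //.
  by left.
by right.
Qed.

Variable (B : set V).
Hypothesis mB : mfin B.

(* [l] lists the corners of a grid of cells of sides [s] that tiles [B]. *)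
Definition tiling l s := [/\ forall i, 0 < s 0 i,
  forall a, a \in l -> cell s a `<=` B &
  forall G g, mfin G -> bcont g ->
    \sum_(a <- l) iint (G `&` cell s a) g = iint (G `&` B) g].

Lemma vol_iint G : mfin G -> vol G = iint G (fun=> 1).
Proof. by move=> mG; rewrite iint_cst// mul1r. Qed.

Lemma tiling_vol l s G : tiling l s -> mfin G ->
  \sum_(a <- l) vol (G `&` cell s a) = vol (G `&` B).
Proof.
move=> [_ _ H] mG; rewrite (vol_iint (mfinI mG mB.1)) -H//; last exact: bcont_cst.
by apply: eq_bigr => a _; rewrite vol_iint//; exact: mfinI (lmeas_cell _ _).
Qed.

Lemma tiling_split l s j : tiling l s -> tiling (splits s j l) (half s j).
Proof.
move=> [s0 lB H]; split.
- move=> i; rewrite updE; case: eqP => _; last exact: s0.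
  by rewrite divr_gt0.
- move=> b /mem_splits[a al ab]; apply: subset_trans (lB a al).
  rewrite (cell_split a (s0 j)) => x xb.
  by case: ab => ab; subst b; [left|right].
move=> G g mG cg; rewrite sum_splits -H//; apply: eq_bigr => a _.
have mGc b : mfin (G `&` cell (half s j) b) by exact: mfinI (lmeas_cell _ _).
rewrite (cell_split a (s0 j)) setIUr iintU//.
apply/eqP; rewrite -subset0 => x [[_ x1] [_ x2]].
by have /eqP := cell_split_disj s a j; rewrite -subset0; apply; split;
  [exact: x1|exact: x2].
Qed.

(* Half of the L^1 distance between the indicator of [E] and the function equal
   on each cell to its average there. *)
Definition energy E l s : R :=
  \sum_(a <- l) vol (E `&` cell s a) * (cvol s - vol (E `&` cell s a)) / cvol s.

Lemma vol_cellI_le E s a : vol (E `&` cell s a) <= cvol s.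
Proof. by rewrite -(vol_cell s a); apply: vol_le;
  [exact: mfin_cell|exact: subIsetr]. Qed.

(* With [x, y] the volumes of [E] in the two halves of a cell, of volume [v]
   each, splitting lowers the energy by [(x - y)^2 / (2 v) <= |x - y| / 2], and
   the sum of [|x - y|] over the cells is seen by translating [E] by half a side. *)
Lemma energy_split E l s j (p : R) : tiling l s -> mfin E -> (perim E <= p%:E)%E ->
  energy E l s <= energy E (splits s j l) (half s j) + s 0 j / 4 * p.
Proof.
move=> til mE PE; have [s0 lB _] := til.
have sj := s0 j.
set s' := half s j; set h := halfstep s j.
have s'0 i : 0 < s' 0 i by have [] := tiling_split j til.
have v0 := cvol_gt0 s'0.
pose e a := vol (E `&` cell s' a).
have mcell b : mfin (E `&` cell s' b) by exact: mfinI (lmeas_cell _ _).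
have eS a : vol (E `&` cell s a) = e a + e (a + h).
  rewrite (cell_split a sj) setIUr volU//.
  apply/eqP; rewrite -subset0 => x [[_ x1] [_ x2]].
  by have /eqP := cell_split_disj s a j; rewrite -subset0; apply; split;
    [exact: x1|exact: x2].
rewrite /energy (cvol_half sj) sum_splits -/s' -/h.
pose D := E `+` trans h E.
have mD : mfin D by apply: mfinY => //; exact: mfin_trans.
(* Within the lower half of each cell, [E] is compared with its translate, which brings in the upper
   half. The upper halves are then added so that the sum runs over the whole tiling. *)
have key : \sum_(a <- l) `|e a - e (a + h)| <= vol D.
  apply: (@le_trans _ _ (\sum_(a <- splits s j l) vol (D `&` cell s' a))); last first.
    rewrite (tiling_vol (tiling_split j til) mD).
    by apply: vol_le => //; exact: subIsetl.
  rewrite sum_splits; apply: ler_sum => a _; rewrite -[leLHS]addr0; apply: lerD;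
    last exact: vol_ge0.
  have -> : e (a + h) = vol (trans h E `&` cell s' a).
    rewrite /e -cell_trans -(vol_trans h); congr vol.
    by apply/funext => x; rewrite /trans/= addrK.
  have mt : mfin (trans h E `&` cell s' a).
    by apply: mfinI (lmeas_cell _ _); exact: mfin_trans.
  apply: le_trans (vol_diff_le (mcell a) mt) _.
  apply: vol_le; first exact: mfinI (lmeas_cell _ _).
  move=> x [[[Ex cx] nx]|[[Ex cx] nx]]; split => //.
    by left; split => // tx; apply: nx.
  by right; split => // tx; apply: nx.
have volD : vol D <= s 0 j / 2 * p.
  have sj2 : 0 < s 0 j / 2 by rewrite divr_gt0.
  have := perim_translate j mE PE sj2; rewrite -/(halfstep s j) -/h.
  suff -> : vol (trans (- h) E `+` E) = vol D by [].
  rewrite -(vol_trans h); congr vol; apply/funext => x.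
  by rewrite /D /trans/setY/setU/setD/= addrK.
apply: (@le_trans _ _ (\sum_(a <- l) (e a * (cvol s' - e a) / cvol s' +
    e (a + h) * (cvol s' - e (a + h)) / cvol s') + \sum_(a <- l) `|e a - e (a + h)| / 2)); last first.
  by rewrite lerD2l -mulr_suml; move: key volD; lra.
rewrite -big_split/=; apply: ler_sum => a _; rewrite eS.
set x := e a; set y := e (a + h); set v := cvol s'.
have x0 : 0 <= x by exact: vol_ge0.
have y0 : 0 <= y by exact: vol_ge0.
have xv : x <= v by exact: vol_cellI_le.
have yv : y <= v by exact: vol_cellI_le.
rewrite (_ : (x + y) * (2 * v - (x + y)) / (2 * v) =
  x * (v - x) / v + y * (v - y) / v + (x - y) ^+ 2 / v / 2); last by field;
    rewrite gt_eqF.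
rewrite lerD2l ler_pM2r ?invr_gt0// ler_pdivrMr// -real_normK ?num_real// expr2.
by apply: ler_wpM2l => //; rewrite ler_norml; apply/andP; split; lra.
Qed.

Definition split_cells (st : seq V * V) j := (splits st.2 j st.1, half st.2 j).

(** An arbitrary duplicate-free [J] makes the induction possible; with all coordinates each side is
    halved exactly once. Sides only shrink, so every split costs at most [r / 4 * p]. *)
Lemma refine_all_spec (J : seq 'I_d.+1) l s (r : R) : uniq J ->
  tiling l s -> (forall i, s 0 i <= r) ->
  let st := foldl split_cells (l, s) J in
  [/\ tiling st.1 st.2,
   forall i, st.2 0 i = if i \in J then s 0 i / 2 else s 0 i &
   forall E p, mfin E -> (perim E <= p%:E)%E ->
     energy E l s <= energy E st.1 st.2 + (size J)%:R * (r / 4 * p)].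
Proof.
elim: J l s => [|j J IH] l s /=.
  by move=> _ til sr; split => // E p _ _; rewrite mul0r addr0.
move=> /andP[jJ uJ] til sr.
have s0 : forall i, 0 < s 0 i by case: til.
have sr' i : half s j 0 i <= r.
  rewrite updE; case: eqP => _; last exact: sr.
  by have := sr j; have := s0 j; lra.
have [til' sE H] := IH (splits s j l) (half s j) uJ (tiling_split j til) sr'.
split => //.
  move=> i; rewrite sE inE !updE; case: (eqVneq i j) => [->|//].
  by rewrite (negbTE jJ).
move=> E p mE PE; apply: le_trans (energy_split j til mE PE) _.
have p0 : 0 <= p by rewrite -lee_fin; apply: le_trans PE; exact: perim_ge0.
have := H E p mE PE.
have : s 0 j / 4 * p <= r / 4 * p by rewrite ler_wpM2r// ler_pM2r.
rewrite -[(size J).+1%:R]natr1 mulrDl mul1r; lra.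
Qed.

Definition refine_all st := foldl split_cells st (enum 'I_d.+1).

(** A C^1 approximation [f] of the indicator is nearly constant on small cells, and the energy of a
    cell is bounded by the distance of the indicator to any constant in [[0, 1]]. The three thirds
    of [e] pay for [f] on [E], for [f] on [B \ E], and for its oscillation. *)
Lemma energy_small E (e : R) : mfin E -> E `<=` B -> 0 < e -> exists2 r, 0 < r &
  forall l s, tiling l s -> (forall i, s 0 i <= r) -> energy E l s <= e.
Proof.
move=> mE EB e0.
have e30 : 0 < e / 3 by rewrite divr_gt0.
have [f [sf f01 fE fB]] := density mE e30.
have bf := sC1c_bcont sf.
have b1f : bcont (fun x => 1 - f x) by apply: bcontB => //; exact: bcont_cst.
have vB1 : 0 < vol B + 1 by rewrite ltr_wpDl ?vol_ge0.
pose w := e / 3 / (vol B + 1).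
have w0 : 0 < w by rewrite divr_gt0.
have [r r0 Hr] := bdsupp_unif_cont bf.1 sf.2 w0.
exists (r / 2); first by rewrite divr_gt0.
move=> l s til sr; have [s0 lB tilI] := til.
have v0 := cvol_gt0 s0.
have mBE : mfin (B `\` E) by exact: mfinD mE.1.
have mI G a : mfin G -> mfin (G `&` cell s a) by move=> mG;
  exact: mfinI (lmeas_cell _ _).
have step a : a \in l -> vol (E `&` cell s a) * (cvol s - vol (E `&` cell s a)) / cvol s <=
   iint (E `&` cell s a) (fun x => 1 - f x) + iint ((B `\` E) `&` cell s a) f + w * vol (B `&` cell s a).
  move=> al; set ee := vol _; set v := cvol s; pose c := f a.
  have /andP[c0 c1] := f01 a.
  have fc x : cell s a x -> `|f a - f x| < w.
    move=> xa; apply: Hr; apply: (@le_lt_trans _ _ (r / 2)); last first.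
      by rewrite gtr_pMr// invf_lt1// ltr1n.
    apply: rv_norm_le => [|i]; first by rewrite divr_ge0// ltW.
    have /andP[u1 u2] := xa i; have := sr i; rewrite !mxE ler_norml => ?.
    by apply/andP; split; lra.
  have vE : v - ee = vol ((B `\` E) `&` cell s a).
    have := volDI (mfin_cell s a) mE.1; rewrite vol_cell -/v setIC -/ee => ->.
    rewrite addrK; congr vol; apply/seteqP; split => x.
      by move=> [xa nx]; split => //; split => //; exact: lB xa.
    by move=> [[_ nx] xa].
  have BE : vol (B `&` cell s a) = v.
    by rewrite setIidr ?vol_cell//; exact: lB.
  have ee0 : 0 <= ee by exact: vol_ge0.
  have eev : ee <= v by exact: vol_cellI_le.
  have i1 : ee * (1 - c) <= iint (E `&` cell s a) (fun x => 1 - f x) + w * ee.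
    rewrite -(iint_cst w (mI _ a mE)) mulrC -(iint_cst (1 - c) (mI _ a mE)).
    rewrite -iintD//; [|exact: mI|exact: bcont_cst].
    apply: iint_le; [exact: mI|exact: bcont_cst|by apply: bcontD => //;
      exact: bcont_cst|].
    by move=> x [_ /fc]; rewrite -/c ltr_norml => /andP[]; lra.
  have i2 : (v - ee) * c <= iint ((B `\` E) `&` cell s a) f + w * (v - ee).
    rewrite vE -(iint_cst w (mI _ a mBE)) mulrC -(iint_cst c (mI _ a mBE)).
    rewrite -iintD//; [|exact: mI|exact: bcont_cst].
    apply: iint_le; [exact: mI|exact: bcont_cst|by apply: bcontD => //;
      exact: bcont_cst|].
    by move=> x [_ /fc]; rewrite -/c ltr_norml => /andP[]; lra.
  rewrite BE; apply: (@le_trans _ _ (ee * (1 - c) + (v - ee) * c));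
    last by move: i1 i2; lra.
  rewrite ler_pdivrMr//.
  (* Of all constants, the cell average need not be the best in [L^1], but half its distance is
     below the full distance of any [c]. *)
  rewrite -subr_ge0 (_ : _ - _ = (1 - c) * ee ^+ 2 + c * (v - ee) ^+ 2); last by ring.
  by apply: addr_ge0; apply: mulr_ge0; rewrite ?sqr_ge0 ?subr_ge0.
apply: (@le_trans _ _ (\sum_(a <- l) (iint (E `&` cell s a) (fun x => 1 - f x) +
    iint ((B `\` E) `&` cell s a) f + w * vol (B `&` cell s a)))).
  by rewrite /energy big_seq [leRHS]big_seq; apply: ler_sum => a; exact: step.
rewrite !big_split/= -mulr_sumr tilI// tilI// (tiling_vol til mB).
rewrite (setIidl EB) setIid (setIidl (@subDsetl _ _ _)).
have := fB _ mBE; rewrite (_ : [disjoint E & B `\` E]); last first.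
  by apply/eqP; rewrite -subset0 => x [? []].
move=> /(_ isT).
have : w * vol B <= e / 3 by rewrite /w mulrAC ler_pdivrMr// ler_pM2l// lerDl.
by move: fE; lra.
Qed.

End cells.

(** * Dyadic refinement of a cube *)

Section poincare.
Variables (R : realType) (d : nat) (a0 : 'rV[R]_d.+1) (r0 : R).
Hypothesis r0_gt0 : 0 < r0.
Notation V := 'rV[R]_d.+1.
Notation T := (caratheodory_type (@leb R d.+1)).
Implicit Types (E G : set V).

Let B := cell (const_mx r0) a0.
Let mB : mfin B := mfin_cell _ _.

Definition level n : seq V * V := iter n (@refine_all _ _) ([:: a0], const_mx r0).
Definition side n : R := r0 / 2 ^+ n.

Lemma side_gt0 n : 0 < side n.
Proof. by rewrite divr_gt0// exprn_gt0. Qed.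

Lemma sideS n : side n.+1 = side n / 2.
Proof. by rewrite /side exprS; field; rewrite expf_neq0. Qed.

Lemma side_small (e : R) : 0 < e -> exists n, side n < e.
Proof.
move=> e0; exists (Num.bound (r0 / e)); rewrite /side ltr_pdivrMr ?exprn_gt0//.
rewrite mulrC -ltr_pdivrMr//; apply: lt_trans (archi_boundP _) _.
  by rewrite ltW// divr_gt0.
by rewrite -natrX ltr_nat ltn_expl.
Qed.

Lemma level_spec n : tiling B (level n).1 (level n).2 /\ (level n).2 = const_mx (side n).
Proof.
elim: n => [|n [til sE]].
  split; last by rewrite /side expr0 divr1.
  split=> [i|a|G g mG cg]; first by rewrite mxE.
    by rewrite /= inE => /eqP ->.
  by rewrite /= big_seq1.
have sr i : (level n).2 0 i <= side n by rewrite sE mxE.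
have [til' s' _] := refine_all_spec mB (enum_uniq 'I_d.+1) til sr.
rewrite /level iterS -/(level n) /refine_all; move: til' s';
  case: (level n) sE => l s /= sE til' s'.
split=> //; apply/rowP => i; rewrite s' mem_enum sE !mxE; exact/esym/sideS.
Qed.

Let E_energy n E := energy E (level n).1 (level n).2.

(** Refining level [k] costs [d.+1 * p * side k / 4], and [side k / 4 = (side k - side k.+1) / 2],
    so the costs telescope. *)
Lemma energy_level n m E p : mfin E -> (perim E <= p%:E)%E ->
  E_energy n E <= E_energy (n + m) E + d.+1%:R * (p * (side n - side (n + m)) / 2).
Proof.
move=> mE PE; elim: m => [|m IH]; first by rewrite addn0 subrr mulr0 mul0r mulr0 addr0.
apply: le_trans IH _.
have [til sE] := level_spec (n + m).
have sr i : (level (n + m)).2 0 i <= side (n + m) by rewrite sE mxE.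
have [_ _ /(_ E p mE PE)] := refine_all_spec mB (enum_uniq 'I_d.+1) til sr.
have lS : level (n + m).+1 =
    foldl (@split_cells _ _) ((level (n + m)).1, (level (n + m)).2) (enum 'I_d.+1).
  by rewrite -surjective_pairing.
rewrite size_enum_ord -lS -/(E_energy (n + m) E) -/(E_energy (n + m).+1 E) => H.
rewrite addnS sideS.
have -> : d.+1%:R * (p * (side n - side (n + m) / 2) / 2) =
  d.+1%:R * (p * (side n - side (n + m)) / 2) + d.+1%:R * (side (n + m) / 4 * p).
  by field.
by move: H; lra.
Qed.

(** The threshold of [energy_small] depends on [E], but it only fixes the level at which refinement
    stops; the resulting bound sees [E] through [p] alone. *)
Lemma poincare n E p : mfin E -> E `<=` B -> (perim E <= p%:E)%E ->
  energy E (level n).1 (level n).2 <= d.+1%:R * (p * side n / 2).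
Proof.
move=> mE EB PE.
have p0 : 0 <= p by rewrite -lee_fin; apply: le_trans PE; exact: perim_ge0.
apply/ler_addgt0Pr => e e0.
have [r r_gt0 Hr] := energy_small mB mE EB e0.
have [m mr] := side_small r_gt0.
have mr' : side (n + m) <= r.
  apply: le_trans (ltW mr); rewrite /side ler_pM2l// lef_pV2 ?posrE ?exprn_gt0//.
  by rewrite ler_eXn2l ?ltr1n// leq_addl.
have [til sE] := level_spec (n + m).
have sr i : (level (n + m)).2 0 i <= r by rewrite sE mxE.
have := Hr _ _ til sr; have := energy_level n m mE PE; rewrite /E_energy.
have : d.+1%:R * (p * (side n - side (n + m)) / 2) <= d.+1%:R * (p * side n / 2).
  rewrite ler_pM2l ?ltr0n// ler_pM2r ?invr_gt0//; apply: ler_wpM2l => //.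
  by rewrite lerBlDr lerDl ltW// side_gt0.
lra.
Qed.

Lemma sum_cells n E : mfin E -> E `<=` B ->
  vol E = \sum_(a <- (level n).1) vol (E `&` cell (level n).2 a).
Proof.
by move=> mE EB; rewrite (tiling_vol mB (level_spec n).1 mE) setIidl.
Qed.

Lemma cvol_level_gt0 n : 0 < cvol (level n).2.
Proof. by apply: cvol_gt0 => i; rewrite (level_spec n).2 mxE side_gt0. Qed.

(* Applied on a scale [side n] so fine that the Poincare constant beats [C]. *)
Lemma vol_lower_bound (C : R) : 0 <=
  C -> exists2 m, 0 < m & forall E, mfin E -> E `<=` B ->
  0 < vol E -> (perim E <= (C * vol E)%:E)%E -> m <= vol E.
Proof.
move=> C0.
have dC : 0 < d.+1%:R * (C + 1) by rewrite mulr_gt0 ?ltr0n// ltr_wpDl.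
have [n] : exists n, side n < (d.+1%:R * (C + 1))^-1 by apply: side_small;
  rewrite invr_gt0.
move=> sn.
have v0 := cvol_level_gt0 n.
exists (cvol (level n).2 / 2); first by rewrite divr_gt0.
move=> E mE EB E0 PE; rewrite leNgt; apply/negP => Ev.
have := poincare n mE EB PE.
(* If [vol E] is below half a cell, no cell is half full and this holds cell by cell, whereas the
   Poincare inequality makes twice the energy smaller than [vol E]. *)
suff : vol E <= 2 * energy E (level n).1 (level n).2.
  have : d.+1%:R * (C * vol E * side n / 2) < vol E / 2.
    have -> : d.+1%:R * (C * vol E * side n / 2) = (d.+1%:R * C * side n) * (vol E / 2).
      by field.
    rewrite gtr_pMl ?divr_gt0//.
    apply: (@le_lt_trans _ _ (d.+1%:R * (C + 1) * side n)).
      by rewrite ler_pM2r ?side_gt0// ler_pM2l ?ltr0n// lerDl.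
    by rewrite mulrC -ltr_pdivlMr// mul1r.
  by lra.
rewrite {1}(sum_cells n mE EB) /energy mulr_sumr; apply: ler_sum => a _.
set e := vol (E `&` _); set v := cvol _.
have ev : e < v / 2 by apply: le_lt_trans Ev; apply: vol_le => //; exact: subIsetl.
have e0 : 0 <= e by exact: vol_ge0.
rewrite mulrA ler_pdivlMr// mulrA [2 * e]mulrC -mulrA ler_wpM2l//.
by move: ev; rewrite -/v; lra.
Qed.

Definition cellU s (l : seq V) : set V := [set x | exists2 a, a \in l & cell s a x].

Lemma cellU_cons s a l : cellU s (a :: l) = cell s a `|` cellU s l.
Proof.
apply/seteqP; split => x.
  move=> [b]; rewrite inE => /orP[/eqP -> ?|bl ?]; first by left.
  by right; exists b.
case=> [xa|[b bl xb]]; first by exists a => //; rewrite mem_head.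
by exists b => //; rewrite inE bl orbT.
Qed.

Lemma mfin_cellU s l : mfin (cellU s l).
Proof.
elim: l => [|a l IH]; last by rewrite cellU_cons; apply: mfinU => //; exact: mfin_cell.
rewrite (_ : cellU s [::] = set0); last by apply/seteqP; split => // x [].
split; last by rewrite leb0.
exact: (@measurable0 _ T).
Qed.

Lemma vol_cellUD s l E : mfin E ->
  vol (cellU s l `\` E) <= \sum_(a <- l) vol (cell s a `\` E).
Proof.
move=> mE; elim: l => [|a l IH].
  rewrite big_nil (_ : _ `\` _ = set0); last by apply/seteqP; split => // x [[]].
  by rewrite /vol leb0.
rewrite big_cons cellU_cons setDUl.
apply: le_trans (volU_le _ _) _;
  [exact: mfinD (mfin_cell _ _) mE.1|exact: mfinD (mfin_cellU _ _) mE.1|].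
by rewrite lerD2l.
Qed.

(** Keep the cells at least half filled: with [e] the part of [E] in a cell of volume [v], the error
    is [min e (v - e) <= 2 e (v - e) / v]. A boolean tuple encodes the choice so that the candidates
    form a [finType]. *)
Lemma cellU_approx n E p : mfin E -> E `<=` B -> (perim E <= p%:E)%E ->
  exists t : (size (level n).1).-tuple bool,
  vol (E `+` cellU (level n).2 (mask t (level n).1)) <= d.+1%:R * (p * side n).
Proof.
move=> mE EB PE.
set l := (level n).1; set s := (level n).2.
have v0 : 0 < cvol s by exact: cvol_level_gt0.
pose e a := vol (E `&` cell s a).
pose P a := cvol s <= 2 * e a.
exists [tuple of map P (in_tuple l)].
have -> : mask (map P l) l = [seq a <- l | P a] by rewrite filter_mask.
set U := cellU s _.
have mU : mfin U by exact: mfin_cellU.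
rewrite volY//.
have mEU : mfin (E `\` U) by exact: mfinD mU.1.
have H1 : vol (E `\` U) <= \sum_(a <- l | ~~ P a) e a.
  rewrite (sum_cells n mEU); last by apply: subset_trans EB; exact: subDsetl.
  rewrite -/l -/s big_seq [leRHS]big_mkcond big_seq; apply: ler_sum => a al.
  case: ifPn => [_|/negPn Pa].
    apply: vol_le; first exact: mfinI (lmeas_cell _ _).
    by move=> x [[]].
  rewrite (_ : _ `&` _ = set0) /vol ?leb0//; apply/seteqP; split => // x [[_ nU] xa].
  by apply: nU; exists a => //; rewrite mem_filter Pa.
have H2 : vol (U `\` E) <= \sum_(a <- l | P a) (cvol s - e a).
  apply: le_trans (vol_cellUD _ _ mE) _; rewrite big_filter; apply: ler_sum => a _.
  have := volDI (mfin_cell s a) mE.1; rewrite vol_cell setIC -/(e a) => ->.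
  by rewrite addrK.
apply: le_trans (lerD H1 H2) _.
have := poincare n mE EB PE; rewrite -/l -/s.
suff : \sum_(a <- l | ~~ P a) e a + \sum_(a <- l | P a) (cvol s - e a) <=
  2 * energy E l s.
  lra.
rewrite addrC big_mkcond [X in _ + X]big_mkcond -big_split/= /energy mulr_sumr.
apply: ler_sum => a _; rewrite -/(e a).
have e0 : 0 <= e a by exact: vol_ge0.
have ev : e a <= cvol s by exact: vol_cellI_le.
rewrite mulrA ler_pdivlMr//.
case: ifPn; rewrite /P -?ltNge => Pa; rewrite ?addr0 ?add0r.
  by rewrite mulrA mulrC ler_wpM2r// subr_ge0.
by rewrite mulrCA ler_wpM2l//; lra.
Qed.

End poincare.

(** * Compactness *)

Section compactness.
Variables (R : realType) (d : nat) (a0 : 'rV[R]_d.+1) (r0 : R).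
Hypothesis r0_gt0 : 0 < r0.
Notation V := 'rV[R]_d.+1.
Notation T := (caratheodory_type (@leb R d.+1)).
Implicit Types (E G : set V).

Let B := cell (const_mx r0) a0.

(** Pigeonhole for an ultrafilter: otherwise the complements of all fibers belong to [F], and their
    finite intersection is empty. *)
Lemma ultra_finType (X : Type) (I : finType) (F : set_system X) (t : X -> I) :
  UltraFilter F -> exists i, F [set k | t k = i].
Proof.
move=> UF; apply: contrapT => /forallNP H.
have : F [set k | forall i, t k <> i].
  by apply: filter_forall => i; have [/H//|] := in_ultra_setVsetC [set k | t k = i] UF.
by move=> /filter_ex[k] /(_ (t k)).
Qed.

(** Completeness for the [L^1] distance, with [X] the lower limit of the sequence. A point whose
    membership never changes from [n] on is in [X] exactly when it is in [Y n], so the tail of the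
    geometric series bounds the difference. *)
Lemma setY_geometric_limit (Y : nat -> set V) : (forall n, mfin (Y n)) ->
  (forall n, vol (Y n `+` Y n.+1) <= 2 / 2 ^+ n) ->
  exists2 X, mfin X & forall n, vol (X `+` Y n) <= 4 / 2 ^+ n.
Proof.
move=> mY HY; pose X := \bigcup_n \bigcap_(m in [set m | (n <= m)%N]) Y m.
have mX : lmeas X.
  apply: (@bigcupT_measurable _ T) => n; apply: (@bigcap_measurable _ T).
    by exists n => /=.
  by move=> m _; exact: (mY m).1.
have sub n : X `+` Y n `<=` \bigcup_m (Y (n + m)%N `+` Y (n + m).+1).
  move=> x xXY; apply: contrapT => H.
  have step m : Y (n + m)%N x <-> Y (n + m).+1 x.
    split=> ym; apply: contrapT => yn; apply: H; exists m => //; [by left|by right].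
  have all m : Y (n + m)%N x <-> Y n x.
    elim: m => [|m [IH1 IH2]]; first by rewrite addn0.
    by rewrite addnS; split => [/step/IH1|/IH2/step].
  case: xXY => [[[k _ Xk] nY]|[Yn nX]].
    by apply: nY; apply/(all k); apply: Xk => /=; exact: leq_addl.
  by apply: nX; exists n => // m /= nm; rewrite -(subnKC nm); apply/all.
have lebXY n : (leb (X `+` Y n) <= (4 / 2 ^+ n)%:E)%E.
  apply: le_trans (le_leb (sub n)) _; apply: le_trans (leb_sigma_subadditive _) _.
  have e0 : 0 <= 4 / 2 ^+ n :> R by rewrite divr_ge0// exprn_ge0.
  apply: (@le_trans _ _ (\sum_(0 <= m <oo) (0 + (4 / 2 ^+ n / (2 ^ m.+1)%:R)%:E))%E).
    apply: lee_nneseries => [m _ _|m _]; first exact: leb_ge0.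
    rewrite add0e lebE; last exact: mfinY.
    rewrite lee_fin; apply: le_trans (HY _) _.
    rewrite natrX exprD exprS le_eqVlt; apply/orP; left; apply/eqP.
    by field; rewrite !expf_neq0.
  apply: le_trans (epsilon_trick _ _ e0) _ => //.
  by rewrite eseries0 ?add0e.
have fX : mfin X.
  split => //; apply: (@le_lt_trans _ _ (leb ((X `+` Y 0) `|` Y 0))).
    by apply: le_leb => x Xx; have [|nY] := pselect (Y 0 x); [right|left; left].
  apply: le_lt_trans (outer_measureU2 _ _ _) _; rewrite lte_add_pinfty ?(mY 0).2//.
  by apply: le_lt_trans (lebXY 0) _; rewrite ltry.
exists X => // n; rewrite -lee_fin -lebE//; exact: mfinY.
Qed.

(** At precision [1 / 2 ^ n], a single union of cells [Y n] is close to [E k] for [F]-most [k]. The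
    [Y n] form a Cauchy sequence whose limit is the limit of the [E k]. *)
Lemma perim_compact (F : set_system nat) (E : nat -> set V) (p : R) : UltraFilter F ->
  (forall k, mfin (E k)) -> (forall k, E k `<=` B) -> (forall k, (perim (E k) <=
    p%:E)%E) ->
  exists2 X, mfin X & forall e, 0 < e -> F [set k | vol (X `+` E k) <= e].
Proof.
move=> UF mE EB PE.
have FF : ProperFilter F by exact: ultra_proper.
have p0 : 0 <= p by rewrite -lee_fin; apply: le_trans (PE 0); exact: perim_ge0.
have /choice[Y HY] : forall n : nat, exists Y, mfin Y /\
    F [set k | vol (E k `+` Y) <= 1 / 2 ^+ n].
  move=> n; have dp : 0 < d.+1%:R * (p + 1) by rewrite mulr_gt0 ?ltr0n// ltr_wpDl.
  have n0 : 0 < 1 / 2 ^+ n :> R by rewrite divr_gt0// exprn_gt0.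
  have [m Hm] := side_small r0_gt0 (divr_gt0 n0 dp).
  have /choice[t Ht] := fun k => cellU_approx r0_gt0 m (mE k) (EB k) (PE k).
  have [i Fi] := ultra_finType t UF.
  exists (cellU (level a0 r0 m).2 (mask i (level a0 r0 m).1)); split;
    first exact: mfin_cellU.
  apply: filterS Fi => k /= ki; rewrite -ki; apply: le_trans (Ht k) _.
  move: Hm; rewrite ltr_pdivlMr// => /ltW; apply: le_trans.
  rewrite mulrA [leRHS]mulrC ler_pM2r ?side_gt0// ler_pM2l ?ltr0n//.
  by rewrite lerDl.
have [|n|X mX HX] := @setY_geometric_limit Y; first by move=> n; exact: (HY n).1.
  (* Two sets of the filter meet, so some [E k] is close to both [Y n] and [Y n.+1]. *)
  have [k [/= k1 k2]] := filter_ex (filterI (HY n).2 (HY n.+1).2).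
  have m1 := (HY n).1; have m2 := (HY n.+1).1.
  apply: le_trans (volY_triangle m1 (mE k) m2) _; rewrite setYC.
  have : 1 / 2 ^+ n.+1 <= 1 / 2 ^+ n :> R.
    rewrite ler_pM2l// lef_pV2 ?posrE ?exprn_gt0//.
    by rewrite exprS ler_peMl ?exprn_ge0// ler1n.
  have -> : 2 / 2 ^+ n = 1 / 2 ^+ n + 1 / 2 ^+ n :> R by rewrite -mulrDl.
  by move: k1 k2; lra.
exists X => // e e0.
have five : 0 < 5 :> R by [].
(* Five is 4, from the geometric limit, plus 1, from the approximation by [Y n]. *)
have [n Hn] := side_small five e0.
apply: filterS (HY n).2 => k /= Hk; apply: le_trans (ltW Hn).
apply: le_trans (volY_triangle mX (HY n).1 (mE k)) _; rewrite [Y n `+` _]setYC.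
have -> : side 5 n = 4 / 2 ^+ n + 1 / 2 ^+ n :> R by rewrite /side -mulrDl;
  congr (_ / _); ring.
exact: lerD.
Qed.

Lemma vol_null E : null E -> vol E = 0.
Proof. by rewrite /null /vol => ->. Qed.

Lemma nullU E G : null E -> null G -> null (E `|` G).
Proof.
move=> E0 G0; apply/eqP; rewrite eq_le leb_ge0 andbT.
by apply: le_trans (outer_measureU2 _ _ _) _; rewrite /= E0 G0 adde0.
Qed.

Lemma null_sub E G : null G -> E `<=` G -> null E.
Proof.
by move=> G0 EG; apply/eqP; rewrite eq_le leb_ge0 andbT -G0; exact: le_leb.
Qed.

Lemma null_small E : (forall e, 0 < e -> (leb E <= e%:E)%E) -> null E.
Proof.
move=> H; apply/eqP; rewrite eq_le leb_ge0 andbT.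
by apply/lee_addgt0Pr => e e0; rewrite add0e; exact: H.
Qed.

(** Lower semicontinuity with [G] itself as the approximation at every precision. *)
Lemma le_perim_null E G : mfin E -> mfin G -> null (E `+` G) -> (perim E <= perim G)%E.
Proof.
move=> mE mG EG.
have [->|Gy] := eqVneq (perim G) +oo%E; first by rewrite leey.
have Gf : perim G \is a fin_num by rewrite ge0_fin_numE ?perim_ge0// lt_neqAle Gy leey.
rewrite -(fineK Gf); apply: perim_lsc => // e e0; exists G; split => //.
  by rewrite vol_null// ltW.
by rewrite EFinD fineK// leeDl// lee_fin ltW.
Qed.

Lemma perim_null E G : mfin E -> mfin G -> null (E `+` G) -> perim E = perim G.
Proof.
move=> mE mG EG; apply/eqP; rewrite eq_le !le_perim_null//.
by rewrite setYC.
Qed.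

Lemma leb_null_eq E G : null (E `+` G) -> leb E = leb G.
Proof.
have H E' G' : null (E' `+` G') -> (leb E' <= leb G')%E.
  move=> N; apply: (@le_trans _ _ (leb ((E' `+` G') `|` G'))).
    by apply: le_leb => x Ex; have [|nY] := pselect (G' x); [right|left; left].
  by apply: le_trans (outer_measureU2 _ _ _) _; rewrite /= N add0e.
by move=> N; apply/eqP; rewrite eq_le !H// setYC.
Qed.

(** Inclusion and disjointness up to null sets pass to [L^1] limits; positive volume passes thanks
    to the uniform bound [m]. The last clause leaves [v] free, to be taken as the limit of the
    ratios. *)
Lemma limit_cluster (N : nat) (Om : set V) (F : set_system nat)
    (E : nat -> 'I_N -> set V) (C : R) : UltraFilter F -> 0 <= C ->
  (forall k, Nset Om (E k)) -> (forall k i, E k i `<=` B) ->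
  (forall k i, (perim (E k i) <= (C * vol (E k i))%:E)%E) ->
  exists2 X : 'I_N -> set V, Nset Om X /\ (forall i, mfin (X i)) & forall i (v : R), 0 <= v ->
    (forall e, 0 < e -> F [set k | (perim (E k i) <= ((v + e) * vol (E k i))%:E)%E]) ->
    (perim (X i) <= (v * vol (X i))%:E)%E.
Proof.
move=> UF C0 NE EB PE.
have FF : ProperFilter F by exact: ultra_proper.
have mB : mfin B by exact: mfin_cell.
have mE k i : mfin (E k i) by apply: mfin_sub mB _ (EB k i); exact: ((NE k).1 i).1.
have vE k i : 0 < vol (E k i).
  by rewrite -lte_fin -lebE//; exact: ((NE k).1 i).2.2.
have [m m0 Hm] := vol_lower_bound a0 r0_gt0 C0.
have PE' k i : (perim (E k i) <= (C * vol B)%:E)%E.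
  by apply: le_trans (PE k i) _; rewrite lee_fin ler_wpM2l//; exact: vol_le.
have /choice[X HX] : forall i, exists X, mfin X /\
    forall e, 0 < e -> F [set k | vol (X `+` E k i) <= e].
  move=> i; have [X mX FX] :=
    perim_compact UF (fun k => mE k i) (fun k => EB k i) (fun k => PE' k i).
  by exists X.
have mX i : mfin (X i) by exact: (HX i).1.
have lebXE k i e : vol (X i `+` E k i) <= e -> (leb (X i `+` E k i) <= e%:E)%E.
  by move=> ?; rewrite lebE ?lee_fin//; exact: mfinY.
exists X.
  split => //; split.
    move=> i; split; first exact: (mX i).1.
    split.
      apply: null_small => e e0.
      have /filter_ex[k /= /lebXE He] := (HX i).2 e e0.
      have Nu := ((NE k).1 i).2.1.
      apply: (@le_trans _ _ (leb ((X i `+` E k i) `|` (E k i `\` Om)))).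
        apply: le_leb => x [Xx nx]; have [Ex|Ex] := pselect (E k i x); first by right.
        by left; left.
      by apply: le_trans (outer_measureU2 _ _ _) _; rewrite /= Nu adde0.
    rewrite lebE// lte_fin.
    have m20 : 0 < m / 2 by rewrite divr_gt0.
    have /filter_ex[k /= Hk] := (HX i).2 _ m20.
    have := Hm _ (mE k i) (EB k i) (vE k i) (PE k i).
    by have := vol_diff_le (mX i) (mE k i); rewrite ler_norml => /andP[]; lra.
  move=> i j ij; apply: null_small => e e0.
  have e20 : 0 < e / 2 by rewrite divr_gt0.
  have [k [/= /lebXE Hi /lebXE Hj]] :=
    filter_ex (filterI ((HX i).2 _ e20) ((HX j).2 _ e20)).
  have Nu := (NE k).2 i j ij.
  apply: (@le_trans _ _ (leb ((X i `+` E k i) `|` (X j `+` E k j) `|` (E k i `&` E k j)))).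
    apply: le_leb => x [Xi Xj]; have [Ei|Ei] := pselect (E k i x); last by left;
      left; left.
    by have [Ej|Ej] := pselect (E k j x); [right|left; right; left].
  apply: le_trans (outer_measureU2 _ _ _) _; rewrite /= Nu adde0.
  apply: le_trans (outer_measureU2 _ _ _) _; rewrite /= (splitr e) EFinD.
  exact: leeD.
move=> i v v0 Hv; apply: perim_lsc => // e e0.
have q0 : 0 < v + vol (X i) + 1 by rewrite ltr_wpDl// addr_ge0// vol_ge0.
(* Ensures [(v + e') (vol (X i) + e') <= v * vol (X i) + e], since [e' <= 1] bounds the quadratic
   term by [e']. *)
pose e' := Num.min 1 (e / (v + vol (X i) + 1)).
have e'0 : 0 < e' by rewrite lt_min ltr01 divr_gt0.
have e'1 : e' <= 1 by rewrite ge_min lexx.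
have e'e : e' * (v + vol (X i) + 1) <= e.
  by rewrite -ler_pdivlMr// ge_min lexx orbT.
have e'e2 : e' <= e.
  by apply: le_trans e'e; rewrite ler_peMr ?(ltW e'0)// lerDr addr_ge0// vol_ge0.
have [k [/= H1 H2]] := filter_ex (filterI ((HX i).2 _ e'0) (Hv _ e'0)).
exists (E k i); split => //; first exact: le_trans e'e2.
apply: le_trans H2 _; rewrite lee_fin.
have vk : vol (E k i) <= vol (X i) + e'.
  by have := vol_diff_le (mX i) (mE k i); rewrite ler_norml => /andP[]; move: H1; lra.
apply: (@le_trans _ _ ((v + e') * (vol (X i) + e'))).
  by rewrite ler_wpM2l// addr_ge0// ltW.
have : e' * e' <= e' * 1 by rewrite ler_pM2l.
move: e'e; rewrite !mulrDr !mulrDl; lra.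
Qed.

End compactness.

(** * Existence of minimizers *)

Section minimizers.
Variables (R : realType) (d : nat) (a0 : 'rV[R]_d.+1) (r0 : R).
Hypothesis r0_gt0 : 0 < r0.
Notation V := 'rV[R]_d.+1.
Notation T := (caratheodory_type (@leb R d.+1)).
Implicit Types (E G Om : set V).

Let B := cell (const_mx r0) a0.

Lemma ratioE E : mfin E -> (perim E < +oo)%E -> Defs.ratio E = (fine (perim E) / vol E)%:E.
Proof.
move=> mE Ey; rewrite /Defs.ratio EFinM fineK// ge0_fin_numE//; exact: perim_ge0.
Qed.

Lemma ratio_ge0 E : mfin E -> (0 <= Defs.ratio E)%E.
Proof.
by move=> mE; rewrite mule_ge0 ?perim_ge0// lee_fin invr_ge0 vol_ge0.
Qed.

Lemma mfin_of_null Om E : null (Om `\` B) -> lmeas E -> null (E `\` Om) -> mfin E.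
Proof.
move=> OB mE EO; split => //.
have EB : null (E `\` B).
  apply: null_sub (nullU EO OB) _ => x [Ex nB].
  by have [Ox|nO] := pselect (Om x); [right|left].
apply: (@le_lt_trans _ _ (leb ((E `\` B) `|` B))).
  by apply: le_leb => x Ex; have [|nB] := pselect (B x); [right|left].
apply: le_lt_trans (outer_measureU2 _ _ _) _; rewrite /= EB add0e.
exact: (mfin_cell _ _).2.
Qed.

Section phi.
Variables (N : nat) (Phi : 'rV[R]_N -> R).
Hypotheses (Phi0 : Phi_nonneg Phi) (Phi1 : Phi_lsc Phi) (Phi2 : Phi_coercive Phi)
  (Phi3 : Phi_monotone Phi).

Lemma Nset_mfin Om (E : 'I_N -> set V) i : null (Om `\` B) -> Nset Om E -> mfin (E i).
Proof. by move=> OB [/(_ i)[mE [EO _]] _]; exact: mfin_of_null OB mE EO. Qed.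

Lemma Nset_vol_gt0 Om (E : 'I_N -> set V) i : null (Om `\` B) -> Nset Om E -> 0 < vol (E i).
Proof.
move=> OB NE; have mE := Nset_mfin i OB NE.
by rewrite -lte_fin -lebE//; exact: (NE.1 i).2.2.
Qed.

Lemma ratios_nonneg Om (E : 'I_N -> set V) : null (Om `\` B) -> Nset Om E ->
  nonnegv (ratios E).
Proof.
by move=> OB NE i; rewrite mxE fine_ge0// ratio_ge0//; exact: Nset_mfin OB NE.
Qed.

Lemma Ncluster_perim Om (E : 'I_N -> set V) i : null (Om `\` B) -> Ncluster Om E ->
  perim (E i) = (ratios E 0 i * vol (E i))%:E.
Proof.
move=> OB [NE Ey]; have mE := Nset_mfin i OB NE.
rewrite mxE ratioE//= divfK ?fineK//; last by rewrite gt_eqF// (Nset_vol_gt0 i OB NE).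
by rewrite ge0_fin_numE//; exact: perim_ge0.
Qed.

(** Chambers lie in [B] only up to null sets, while the cell arguments want genuine inclusion; the
    intersection with [B] changes neither perimeters nor volumes. *)
Lemma Ncluster_localize Om (E : 'I_N -> set V) : null (Om `\` B) -> Ncluster Om E ->
  let E' := fun i => E i `&` B in Ncluster Om E' /\ ratios E' = ratios E.
Proof.
move=> OB [NE Ey] E'.
have mB : mfin B by exact: mfin_cell.
have mE i : mfin (E i) by exact: Nset_mfin OB NE.
have mE' i : mfin (E' i) by exact: mfinI (mE i) mB.1.
have E'E i : null (E' i `+` E i).
  apply: null_sub (nullU (NE.1 i).2.1 OB) _ => x [[[Ex _] nE]//|[Ex nx]].
  have [Ox|nO] := pselect (Om x); [right|by left].
  by split => // Bx; apply: nx.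
have P i : perim (E' i) = perim (E i) by exact: perim_null.
have L i : leb (E' i) = leb (E i) by exact: leb_null_eq.
split; last by apply/rowP => i; rewrite !mxE /Defs.ratio P L.
split; last by move=> i; rewrite P.
split => [i|i j ij].
  split; first exact: (mE' i).1.
  split; last by rewrite L; exact: (NE.1 i).2.2.
  by apply: null_sub (NE.1 i).2.1 _ => x [[Ex _] nO].
by apply: null_sub (NE.2 i j ij) _ => x [[Ei _] [Ej _]].
Qed.

(** Openness is replaced by the existence of one cluster, so that the theorem also applies inside
    the chambers of an [N]-set. *)
Theorem HPhi_attained Om : null (Om `\` B) ->
  (exists E0 : 'I_N -> set V, Ncluster Om E0) ->
  exists E : 'I_N -> set V, Ncluster Om E /\ (Phi (ratios E))%:E = HPhi Phi Om.
Proof.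
move=> OB [E0 CE0].
have H_le (E : 'I_N -> set V) : Ncluster Om E -> (HPhi Phi Om <= (Phi (ratios E))%:E)%E.
  by move=> CE; apply: ereal_inf_lbound; exists E.
have H0 : (0 <= HPhi Phi Om)%E.
  apply: le_ereal_inf_tmp => _ [E CE <-]; rewrite lee_fin; apply: Phi0.
  exact: ratios_nonneg OB CE.1.
have Hf : HPhi Phi Om \is a fin_num.
  by rewrite ge0_fin_numE//; apply: le_lt_trans (H_le _ CE0) _; rewrite ltry.
set h := fine (HPhi Phi Om).
have hE : HPhi Phi Om = h%:E by rewrite fineK.
have /choice[E HE] : forall k : nat, exists E : 'I_N -> set V, Ncluster Om E /\
    (forall i, E i `<=` B) /\ Phi (ratios E) < h + k.+1%:R^-1.
  move=> k.
  have : (HPhi Phi Om < (h + k.+1%:R^-1)%:E)%E by rewrite hE lte_fin ltrDl.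
  move=> /ereal_inf_lt[_ [E CE <-]]; rewrite lte_fin => Ek.
  have [CE' rE'] := Ncluster_localize OB CE.
  by exists (fun i => E i `&` B); split => //; split; [move=> i;
    exact: subIsetr|rewrite rE'].
have CE k : Ncluster Om (E k) by exact: (HE k).1.
have rE0 k : nonnegv (ratios (E k)) by exact: ratios_nonneg OB (CE k).1.
have [dl dl0 Hdl] := Phi2.
have h0 : 0 <= h by rewrite -lee_fin -hE.
(* By coercivity [dl] times any ratio is at most [Phi (ratios (E k)) < h + 1 / (k + 1) <= h + 1]. *)
pose C := (h + 1) / dl.
have C0 : 0 <= C by rewrite divr_ge0 ?addr_ge0// ltW.
have rC k i : ratios (E k) 0 i <= C.
  rewrite /C ler_pdivlMr// mulrC.
  apply: (@le_trans _ _ (dl * \sum_j ratios (E k) 0 j)).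
    rewrite ler_pM2l// (bigD1 i)//= lerDl; apply: sumr_ge0 => j _; exact: rE0.
  apply: le_trans (Hdl _ (rE0 k)) _; apply: le_trans (ltW (HE k).2.2) _.
  by rewrite lerD2l invf_le1// ler1n.
have [F [UF ooF]] := ultraFilterLemma (eventually_filter : ProperFilter \oo).
have FF : ProperFilter F by exact: ultra_proper.
have [X [NX mX] HX] :=
  limit_cluster r0_gt0 UF C0 (fun k => (CE k).1) (fun k => (HE k).2.1)
  (fun k i => ltac:(rewrite (Ncluster_perim i OB (CE k)) lee_fin ler_wpM2r ?vol_ge0//)).
(* The ratio vectors stay in a compact ball, hence cluster somewhere; along an ultrafilter a cluster
   point is a limit. *)
have [v Hv] : exists v : 'rV[R]_N, forall U, nbhs v U -> F [set k | U (ratios (E k))].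
  have cK := @closed_ball_rv_compact R N C.
  have FK : F [set k | `|ratios (E k)| <= C].
    by apply: filterE => k /=; apply: rv_norm_le => // i; rewrite ger0_norm;
      [exact: rC|exact: rE0].
  have [v [_ clv]] := cK ((fun k => ratios (E k)) @ F) _ FK.
  exists v => U Uv; have [//|nU] := in_ultra_setVsetC [set k | U (ratios (E k))] UF.
  have [w [/= nUw Uw]] := clv (~` U) U nU Uv.
  by [].
have near_v i e : 0 < e -> F [set k | `|v 0 i - ratios (E k) 0 i| < e].
  move=> e0; apply: filterS (Hv _ (nbhsx_ballx v e e0)) => k.
  rewrite -ball_normE/= => H; apply: le_lt_trans H.
  by have := coord_le_norm (v - ratios (E k)) i; rewrite !mxE.
have v0 : nonnegv v.
  move=> i; rewrite leNgt; apply/negP => vi.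
  have nvi : 0 < - v 0 i by rewrite oppr_gt0.
  have [k /=] := filter_ex (near_v i _ nvi); rewrite ltr_norml => /andP[u _].
  by have := rE0 k i; move: u; lra.
have PX i : (perim (X i) <= (v 0 i * vol (X i))%:E)%E.
  apply: HX => // e e0; apply: filterS (near_v i e e0) => k /=.
  rewrite (Ncluster_perim i OB (CE k)) lee_fin ltr_norml => /andP[u _].
  by rewrite ler_wpM2r ?vol_ge0//; lra.
have CX : Ncluster Om X.
  by split => // i; apply: le_lt_trans (PX i) _; rewrite ltry.
exists X; split => //; apply/eqP; rewrite eq_le H_le// andbT hE lee_fin.
have Xv : Phi (ratios X) <= Phi v.
  apply: Phi3 => //; first exact: ratios_nonneg OB NX.
  move=> i; have vX := Nset_vol_gt0 i OB NX.
  by have := PX i; rewrite (Ncluster_perim i OB CX) lee_fin ler_pM2r.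
apply: le_trans Xv _; apply/ler_addgt0Pr => e e0.
have e20 : 0 < e / 2 by rewrite divr_gt0.
have F1 := Hv _ (Phi1 v0 e20).
have F2 : F [set k | (k.+1%:R^-1 : R) < e / 2].
  by apply: ooF; exact: near_infty_natSinv_lt (PosNum e20).
have [k [/= k1 k2]] := filter_ex (filterI F1 F2).
have := lt_le_trans (HE k).2.2 (lerD (lexx h) (ltW k2)).
by have := k1 (rE0 k); lra.
Qed.

End phi.

(* The case [N = 1], [Phi v = v] of [HPhi_attained]. *)
Lemma cheeger_attained G : null (G `\` B) -> (cheeger G < +oo)%E ->
  exists E, [/\ lmeas E, null (E `\` G), (0 < leb E)%E, (perim E < +oo)%E &
    Defs.ratio E = cheeger G].
Proof.
move=> GB Gy.
pose Phi (v : 'rV[R]_1) := v 0 0.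
have Phi1 : Phi_lsc Phi.
  move=> v _ e e0; near=> w; move=> _.
  have : `|v - w| < e by near: w; rewrite nearE; have := nbhsx_ballx v e e0;
    rewrite -ball_normE.
  move=> vw; have := le_lt_trans (coord_le_norm (v - w) 0) vw.
  by rewrite !mxE /Phi ltr_norml => /andP[]; lra.
have Phi2 : Phi_coercive Phi by exists 1 => // v _; rewrite big_ord1 mul1r.
have single E : Nset G (fun _ : 'I_1 => E) <-> lmeas E /\ null (E `\` G) /\ (0 < leb E)%E.
  split=> [[/(_ 0)//]|HE]; split => // i j.
  by rewrite (ord1 i) (ord1 j) eqxx.
have fin_ratio E : mfin E -> (Defs.ratio E < +oo)%E -> 0 < vol E -> (perim E < +oo)%E.
  move=> mE + vE; rewrite /Defs.ratio; have := perim_ge0 mE;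
    case: (perim E) => [p|//|//].
    by move=> *; rewrite ltry.
  by rewrite mulyr gtr0_sg ?invr_gt0// mul1e.
have [E0 [HE0 E0y]] : exists E, (lmeas E /\ null (E `\` G) /\ (0 < leb E)%E) /\ (Defs.ratio E < +oo)%E.
  by move/ereal_inf_lt : Gy => [_ [E HE <-] Ey]; exists E.
have CE E : (lmeas E /\ null (E `\` G) /\ (0 < leb E)%E) -> (Defs.ratio E < +oo)%E ->
    Ncluster G (fun _ : 'I_1 => E).
  move=> HE Ey; have NE := (single E).2 HE; split => // _.
  by apply: fin_ratio => //; [exact: Nset_mfin 0 GB NE|exact: Nset_vol_gt0 0 GB NE].
have [|||E [CE' HE]] := @HPhi_attained 1 Phi _ Phi1 Phi2 _ G GB.
- by move=> v v0; exact: v0.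
- by move=> v w _ _; exact.
- by exists (fun=> E0); exact: CE.
have [mE [EG E_gt0]] := CE'.1.1 0.
have mfE : mfin (E 0) by exact: mfin_of_null GB mE EG.
exists (E 0); split => //; first exact: CE'.2.
apply/eqP; rewrite eq_le; apply/andP; split; last first.
  by apply: ereal_inf_lbound; exists (E 0).
apply: le_ereal_inf_tmp => _ [A HA <-].
(* [HPhi] only ranges over sets of finite perimeter; the other competitors for [cheeger] have
   infinite ratio. *)
have [->|Ay] := eqVneq (Defs.ratio A) +oo%E; first by rewrite leey.
have {}Ay : (Defs.ratio A < +oo)%E by rewrite lt_neqAle Ay leey.
have CA := CE A HA Ay.
have : ((Phi (ratios E))%:E <= (Phi (ratios (fun=> A)))%:E)%E.
  by rewrite HE; apply: ereal_inf_lbound; exists (fun=> A).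
rewrite /Phi !mxE !fineK//.
  by rewrite ratioE//; [exact: Nset_mfin 0 GB CA.1|exact: CA.2 0].
by rewrite ratioE//; exact: CE'.2.
Unshelve. all: by end_near. Qed.

Lemma exists_Ncluster N Om : open Om -> Om !=set0 -> exists E : 'I_N -> set V, Ncluster Om E.
Proof.
move=> oO [x0 Ox0].
have /nbhs_ballP[e /= e0 xeO] : nbhs x0 Om by exact: open_nbhs_nbhs.
(* The boxes are stacked along coordinate 0 with period [t] and thickness [t / 2]: the gaps keep
   these closed boxes disjoint, and the stack stays within [e / 2] of [x0]. *)
pose t := e / 2 / N.+1%:R.
have t0 : 0 < t by rewrite !divr_gt0// ltr0n.
have tN : t * N.+1%:R = e / 2 by rewrite /t divfK// pnatr_eq0.
pose a (i : 'I_N) : V := upd x0 0 (x0 0 0 + t * i%:R).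
pose b (i : 'I_N) : V := upd (x0 + const_mx (e / 2)) 0 (x0 0 0 + t * i%:R + t / 2).
exists (fun i => box (a i) (b i)).
have sub i : box (a i) (b i) `<=` Om.
  move=> x xab; apply: xeO; rewrite -ball_normE/=.
  apply: (@le_lt_trans _ _ (e / 2)); last by rewrite gtr_pMr// invf_lt1// ltr1n.
  apply: rv_norm_le => [|k]; first by rewrite divr_ge0// ltW.
  have := xab k; rewrite !updE !mxE ler_norml; case: (eqVneq k 0) => [->|_] /andP[u v].
    have ti0 : 0 <= t * i%:R by rewrite mulr_ge0// ltW.
    have tiN : t * i%:R + t <= e / 2.
      have -> : t * i%:R + t = t * i.+1%:R by rewrite -[i.+1%:R]natr1 mulrDr mulr1.
      by rewrite -tN ler_pM2l// ler_nat ltnS ltnW.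
    by apply/andP; split; lra.
  by apply/andP; split; lra.
split; last by move=> i; exact: perim_box_lty.
split=> [i|i j ij].
  split; first exact: lmeas_box.
  split.
    rewrite (_ : _ `\` _ = set0); first exact: leb0.
    by apply/seteqP; split => // x [/sub].
  rewrite leb_box lte_fin; apply: prodr_gt0 => k _; rewrite lt_max; apply/orP; right.
  rewrite !updE !mxE; case: (eqVneq k 0) => [_|_].
    by rewrite addrAC subrr add0r divr_gt0.
  by rewrite addrAC subrr add0r divr_gt0.
rewrite (_ : _ `&` _ = set0); first exact: leb0.
apply/seteqP; split => // x [/(_ 0) + /(_ 0)];
  rewrite !updE/= => /andP[u v] /andP[u' v'].
wlog ltij : i j ij u v u' v' / (i < j)%N.
  move=> H; case: (ltngtP i j) => [|ji|/val_inj ijE]; first exact: H ij u v u' v'.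
    by apply: (H j i) => //; rewrite eq_sym.
  by move: ij; rewrite ijE eqxx.
have : t * i%:R + t <= t * j%:R.
  have -> : t * i%:R + t = t * i.+1%:R by rewrite -[i.+1%:R]natr1 mulrDr mulr1.
  by rewrite ler_pM2l// ler_nat.
by move: v u'; lra.
Qed.

(** Each [X i] competes in its own Cheeger constant, which closes the chain [L <= Phi (cheeger X) <=
    Phi (ratios X) = H <= L]. *)
Theorem eigen_cluster N (Phi : 'rV[R]_N -> R) Om (X : 'I_N -> set V) :
  Phi_nonneg Phi -> Phi_monotone Phi -> null (Om `\` B) ->
  Ncluster Om X -> (Phi (ratios X))%:E = HPhi Phi Om ->
  PhiExt Phi (fun i => cheeger (X i)) = LPhi Phi Om.
Proof.
move=> Phi0 Phi3 OB CX HX.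
have cheeger_ge0 G : null (G `\` B) -> (0 <= cheeger G)%E.
  move=> GB; apply: le_ereal_inf_tmp => _ [A [mA [AG _]] <-]; apply: ratio_ge0.
  exact: mfin_of_null GB mA AG.
have GB (G : 'I_N -> set V) i : Nset Om G -> null (G i `\` B).
  move=> NG; apply: null_sub (nullU (NG.1 i).2.1 OB) _ => x [Gx nB].
  by have [Ox|nO] := pselect (Om x); [right|left].
have chX i : (cheeger (X i) <= Defs.ratio (X i))%E.
  apply: ereal_inf_lbound; exists (X i) => //.
  have [mX [_ X0]] := CX.1.1 i; split => //; split => //.
  by rewrite setDv; exact: leb0.
have rX i : Defs.ratio (X i) \is a fin_num.
  by rewrite ratioE//; [exact: Nset_mfin OB CX.1|exact: CX.2].
have chXf i : cheeger (X i) \is a fin_num.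
  rewrite ge0_fin_numE ?cheeger_ge0//; last exact: GB CX.1.
  by apply: le_lt_trans (chX i) _; rewrite ltey_eq rX.
apply/eqP; rewrite eq_le; apply/andP; split; last first.
  by apply: ereal_inf_lbound; exists X => //; exact: CX.1.
have LX : (PhiExt Phi (fun i => cheeger (X i)) <= HPhi Phi Om)%E.
  rewrite /PhiExt ifT; last by apply/forallP.
  rewrite -HX lee_fin; apply: Phi3.
  - by move=> i; rewrite mxE fine_ge0// cheeger_ge0//; exact: GB CX.1.
  - exact: ratios_nonneg OB CX.1.
  by move=> i; rewrite !mxE fine_le.
apply: le_trans LX _; apply: le_ereal_inf_tmp => _ [G NG <-].
rewrite /PhiExt; case: ifPn => [/forallP Gf|_]; last by rewrite leey.
have /choice[A HA] : forall i, exists A, [/\ lmeas A, null (A `\` G i), (0 < leb A)%E,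
    (perim A < +oo)%E & Defs.ratio A = cheeger (G i)].
  move=> i; apply: cheeger_attained; first exact: GB NG.
  by rewrite ltey_eq Gf.
apply: ereal_inf_lbound; exists A; last first.
  by congr (Phi _)%:E; apply/rowP => i; rewrite !mxE; have [_ _ _ _ ->] := HA i.
split; last by move=> i; have [] := HA i.
split=> [i|i j ij].
  have [mA AG A0 _ _] := HA i; split => //; split => //.
  apply: null_sub (nullU AG (NG.1 i).2.1) _ => x [Ax nO].
  by have [Gx|nG] := pselect (G i x); [right|left].
have [_ AGi _ _ _] := HA i; have [_ AGj _ _ _] := HA j.
apply: null_sub (nullU (nullU AGi AGj) (NG.2 i j ij)) _ => x [Ai Aj].
have [Gi|nG] := pselect (G i x); last by left; left.
by have [Gj|nG] := pselect (G j x); [right|left; right].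
Qed.

End minimizers.

Theorem mainTheorem5 (R : realType) (d N : nat) (Omega : set 'rV[R]_d)
    (Phi : 'rV[R]_N -> R) :
  (0 < d)%N ->
  open Omega -> Omega !=set0 ->
  (exists M : R, forall x, Omega x -> `|x| <= M) ->
  Phi_nonneg Phi -> Phi_lsc Phi -> Phi_coercive Phi -> Phi_monotone Phi ->
  (exists E : 'I_N -> set 'rV[R]_d,
      Ncluster Omega E /\ (Phi (ratios E))%:E = HPhi Phi Omega) /\
  (exists E : 'I_N -> set 'rV[R]_d,
      Ncluster Omega E /\
      PhiExt Phi (fun i => cheeger (E i)) = LPhi Phi Omega).
Proof.
case: d Omega => // d Omega _ oO O0 [M OM] Phi0 Phi1 Phi2 Phi3.
(* The added 1 keeps [Omega] off the upper faces, which the half-open cell does not contain, and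
   gives the cell positive sides. *)
pose m := `|M| + 1.
have m0 : 0 < m by rewrite ltr_wpDl.
have mm0 : 0 < m + m by rewrite addr_gt0.
have OB : null (Omega `\` cell (const_mx (m + m)) (const_mx (- m))).
  rewrite (_ : _ `\` _ = set0); first exact: leb0.
  apply/seteqP; split => // x [/OM xM]; apply => i; rewrite !mxE.
  have := le_trans (coord_le_norm x i) xM; have := ler_norm M.
  by rewrite ler_norml /m => ? /andP[? ?]; apply/andP; split; lra.
have [E [CE HE]] := HPhi_attained mm0 Phi0 Phi1 Phi2 Phi3 OB (exists_Ncluster N oO O0).
split; exists E; split => //.
exact: (eigen_cluster mm0 Phi0 Phi3 OB CE HE).
Qed.
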